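(* Suppose $X_1, X_2, \ldots, X_k$ are subprojective Banach spaces with unconditional FDD, and $\tilde{\otimes}$ is a tensor product. Suppose, furthermore, that for every finite increasing sequence $\mathbf{i} = [1 \leq i_1 < \ldots < i_\ell \leq k]$ there exists an unconditional sequence space $\mathcal{E}_{\mathbf{i}}$ such that $X_{i_1} \tilde{\otimes} X_{i_2} \tilde{\otimes} \ldots \tilde{\otimes} X_{i_\ell}$ satisfies the $\mathcal{E}_{\mathbf{i}}$-estimate. Then $X_1 \tilde{\otimes} X_2 \tilde{\otimes} \ldots \tilde{\otimes} X_k$ is subprojective.
   Context: All Banach spaces are assumed infinite dimensional unless specified otherwise, and subspaces are closed and infinite dimensional. A Banach space $X$ is subprojective if every subspace $Y \subset X$ contains a further subspace $Z \subset Y$ that is complemented in $X$. Unconditional FDD: $X_i$ has an unconditional FDD implemented by finite rank projections $(P'_{in})_{n}$ if $P'_{in}P'_{im} = 0$ for $n \neq m$, $\lim_N \sum_{n=1}^N P'_{in} x = x$ for every $x\in X_i$, and $\sup_{N,\pm}\|\sum_{n=1}^N \pm P'_{in}\| < \infty$. Such projections are fixed for each $X_i$, and $E_{in} = \mathrm{ran}(P'_{in})$. Tensor product: $\tilde\otimes$ assigns to each finite tuple of Banach spaces $Y_1,\dots,Y_m$ (finite dimensional ones allowed) the completion $Y_1\tilde\otimes\cdots\tilde\otimes Y_m$ of the algebraic tensor product in a norm satisfying $\|y_1\otimes\cdots\otimes y_m\| = \prod\|y_i\|$ and $\|T_1\otimes\cdots\otimes T_m : Y_1\tilde\otimes\cdots\tilde\otimes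 Y_m \to Y_1'\tilde\otimes\cdots\tilde\otimes Y_m'\| \leq \prod \|T_i\|$ for bounded operators $T_i : Y_i\to Y_i'$; a one-fold product is the space itself, and a one-dimensional factor can be dropped (up to canonical isomorphism). Block-diagonal sequences: a sequence $(w_j)_{j=1}^\infty \subset X_{1}\otimes\cdots\otimes X_{k}$ is block-diagonal if there is a sequence $0 = N_1 < N_2 < \ldots$ such that $$w_j \in \Big(\sum_{n=N_j+1}^{N_{j+1}} E_{1n}\Big)\otimes \Big(\sum_{n=N_j+1}^{N_{j+1}} E_{2n}\Big)\otimes\cdots\otimes\Big(\sum_{n=N_j+1}^{N_{j+1}} E_{kn}\Big)$$ for all $j$; the same definition is used for the product of any subfamily $X_{i_1},\dots,X_{i_\ell}$. An unconditional sequence space is a Banach space of scalar sequences in which the unit vectors form an unconditional basis. For such a space $\mathcal{E}$, $X_1\tilde\otimes\cdots\tilde\otimes X_k$ satisfies the $\mathcal{E}$-estimate if there is a constant $C\geq 1$ such that for any block-diagonal sequence $(w_j)$ (with finitely many nonzero terms) $$C^{-1}\|(\|w_j\|)_{j}\|_{\mathcal{E}} \leq \Big\|\sum_j w_j\Big\| \leq C\|(\|w_j\|)_{j}\|_{\mathcal{E}};$$ similarly for subfamilies. *)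

(* Defs.v *)
From HB Require Import structures.
From mathcomp Require Import all_boot all_order all_algebra.
From mathcomp Require Import complex.
From mathcomp Require Import all_classical all_reals all_analysis.

Set Implicit Arguments.
Unset Strict Implicit.
Unset Printing Implicit Defensive.

Import Order.TTheory GRing.Theory Num.Theory.
Import numFieldNormedType.Exports.

Local Open Scope classical_set_scope.
Local Open Scope ring_scope.

(* The scalar field is kept abstract as [K : numFieldType], so that real and
   complex Banach spaces are handled together; norms are then [K]-valued. *)
Definition real_or_complex (K : numFieldType) : Prop :=
  exists R : realType, K = R :> numFieldType \/ K = R[i]%C :> numFieldType.

Section LinearAlgebra.
Context {K : numFieldType}.

Definition lin_subspace (V : lmodType K) (A : set V) : Prop :=
  A 0 /\ forall (a : K) (u v : V), A u -> A v -> A (a *: u + v).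

Definition lin_span (V : lmodType K) (A : set V) : set V :=
  [set x | exists n (c : 'I_n -> K) (v : 'I_n -> V),
     (forall i, A (v i)) /\ x = \sum_(i < n) c i *: v i].

Definition finite_dim (V : lmodType K) (A : set V) : Prop :=
  exists2 F : set V, finite_set F & A `<=` lin_span F.

Definition infinite_dim (V : lmodType K) (A : set V) : Prop :=
  ~ finite_dim A.

Definition multilinear m (Y : 'I_m -> lmodType K) (V : lmodType K)
    (f : (forall i, Y i) -> V) : Prop :=
  forall (y : forall i, Y i) (i : 'I_m), linear (fun u : Y i => f (dfwith y i u)).

Definition is_alg_tensor m (Y : 'I_m -> lmodType K) (A : lmodType K)
    (t : (forall i, Y i) -> A) : Prop :=
  multilinear t /\
  forall (V : lmodType K) (f : (forall i, Y i) -> V), multilinear f ->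
    exists2 g : {linear A -> V}, (forall y, g (t y) = f y) &
      forall h : {linear A -> V}, (forall y, h (t y) = f y) -> h =1 g.

End LinearAlgebra.

Section BanachSpaces.
Context {K : numFieldType}.

Definition complemented (X : completeNormedModType K) (Z : set X) : Prop :=
  exists Q : {linear X -> X},
    [/\ continuous Q, forall x, Q (Q x) = Q x & range Q = Z].

Definition closed_inf_subspace (X : completeNormedModType K) (A : set X) :=
  [/\ lin_subspace A, closed A & infinite_dim A].

Definition subprojective (X : completeNormedModType K) : Prop :=
  forall Y : set X, closed_inf_subspace Y ->
    exists Z : set X, [/\ closed_inf_subspace Z, Z `<=` Y & complemented Z].

Definition norm_bounded_by (X Y : normedModType K) (f : X -> Y) (M : K) :=
  0 <= M /\ forall x, `|f x| <= M * `|x|.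

Definition isomorphism (X Y : normedModType K) (f : X -> Y) : Prop :=
  continuous f /\
  exists g : Y -> X, [/\ continuous g, cancel f g & cancel g f].

Definition unconditional_FDD (X : completeNormedModType K)
    (P : nat -> X -> X) : Prop :=
  [/\ forall n, [/\ linear (P n), continuous (P n),
                  forall x, P n (P n x) = P n x & finite_dim (range (P n))],
      forall n m, n != m -> forall x, P n (P m x) = 0,
      forall x, (fun N => \sum_(n < N) P n x) @ \oo --> x &
      exists M : K, forall (N : nat) (eps : nat -> bool),
        norm_bounded_by (fun x : X => \sum_(n < N) (-1) ^+ eps n *: P n x) M].

End BanachSpaces.

(* [tens_space Y] is the completion of the algebraic tensor product [tens_alg Y] for the
   norm [z |-> `|tens_incl z|].  Tuples are nonempty, hence indexed by ['I_m.+1]. *)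
Record tensor_product (K : numFieldType) := TensorProduct {
  tens_alg : forall m, ('I_m.+1 -> completeNormedModType K) -> lmodType K;
  tens_pure : forall m (Y : 'I_m.+1 -> completeNormedModType K),
    (forall i, Y i) -> tens_alg Y;
  tens_pureP : forall m (Y : 'I_m.+1 -> completeNormedModType K),
    is_alg_tensor (@tens_pure m Y);
  tens_space : forall m, ('I_m.+1 -> completeNormedModType K) ->
    completeNormedModType K;
  tens_incl : forall m (Y : 'I_m.+1 -> completeNormedModType K),
    {linear tens_alg Y -> tens_space Y};
  tens_incl_inj : forall m (Y : 'I_m.+1 -> completeNormedModType K),
    injective (@tens_incl m Y);
  tens_incl_dense : forall m (Y : 'I_m.+1 -> completeNormedModType K),
    closure (range (@tens_incl m Y)) = setT;
  norm_tens_pure : forall m (Y : 'I_m.+1 -> completeNormedModType K)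
    (y : forall i, Y i), `|tens_incl Y (tens_pure y)| = \prod_(i < m.+1) `|y i|;
  (* ||T_1 (x) ... (x) T_m|| <= ||T_1|| ... ||T_m|| *)
  tensor_map : forall m (Y Y' : 'I_m.+1 -> completeNormedModType K)
    (T : forall i, {linear Y i -> Y' i}) (M : 'I_m.+1 -> K),
    (forall i, norm_bounded_by (T i) (M i)) ->
    exists2 S : {linear tens_space Y -> tens_space Y'},
      forall y : forall i, Y i,
        S (tens_incl Y (tens_pure y))
          = tens_incl Y' (tens_pure (fun i => T i (y i))) &
      norm_bounded_by S (\prod_(i < m.+1) M i);
  (* by [norm_tens_pure], this isomorphism is isometric *)
  one_fold : forall Y : 'I_1 -> completeNormedModType K,
    exists2 J : {linear Y ord0 -> tens_space Y}, isomorphism J &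
      forall y : forall i, Y i, J (y ord0) = tens_incl Y (tens_pure y);
  drop_factor : forall m (Y : 'I_m.+2 -> completeNormedModType K)
    (i : 'I_m.+2) (e : Y i), e != 0 -> lin_span [set e] = setT ->
    exists2 J : {linear tens_space (fun j => Y (lift i j)) -> tens_space Y},
      isomorphism J &
      forall y : forall j, Y j, y i = e ->
        J (tens_incl (fun j => Y (lift i j))
             (tens_pure (fun j => y (lift i j))))
          = tens_incl Y (tens_pure y)
}.

(* [coord n x] is the [n]-th term of [x], which is a scalar sequence by
   [coord_inj]; the unit vectors form an unconditional basis when the rank one
   projections [x |-> coord n x *: unit_vec n] implement an unconditional FDD. *)
Record uncond_seq_space (K : numFieldType) := UncondSeqSpace {
  seq_space :> completeNormedModType K;
  coord : nat -> {scalar seq_space};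
  coord_inj : forall x y, (forall n, coord n x = coord n y) -> x = y;
  unit_vec : nat -> seq_space;
  coord_unit_vec : forall n m, coord m (unit_vec n) = (m == n)%:R;
  unit_vec_basis : unconditional_FDD (fun n x => coord n x *: unit_vec n)
}.

Section Estimates.
Context {K : numFieldType} (T : tensor_product K).
Context (m : nat) (X : 'I_m.+1 -> completeNormedModType K).
Context (P : forall i, nat -> X i -> X i).

(* sum of the ranges E_(i, n) for p <= n < q *)
Definition FDD_block (i : 'I_m.+1) (p q : nat) : set (X i) :=
  [set x | exists2 u : nat -> X i,
     (forall n, range (@P i n) (u n)) & x = \sum_(p <= n < q) u n].

Definition block_diagonal (w : nat -> tens_alg T X) : Prop :=
  exists N : nat -> nat, [/\ N 0%N = 0%N, forall j, (N j < N j.+1)%N &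
    forall j, lin_span
      [set z | exists2 y : forall i, X i,
         (forall i, FDD_block (N j) (N j.+1) (y i)) & z = tens_pure T y] (w j)].

Definition satisfies_estimate (E : uncond_seq_space K) : Prop :=
  exists2 C : K, 1 <= C &
    forall (w : nat -> tens_alg T X) (J : nat), block_diagonal w ->
      (forall j, (J <= j)%N -> w j = 0) ->
      let normE := `|\sum_(j < J) `|tens_incl T X (w j)| *: unit_vec E j| in
      C^-1 * normE <= `|tens_incl T X (\sum_(j < J) w j)| /\
      `|tens_incl T X (\sum_(j < J) w j)| <= C * normE.

End Estimates.

(* Main.v *)
From HB Require Import structures.
Require Import Defs.
From mathcomp Require Import all_boot all_order all_algebra.
From mathcomp Require Import complex.
From mathcomp Require Import all_classical all_reals all_analysis.
From mathcomp Require Import ring lra.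

Set Implicit Arguments.
Unset Strict Implicit.
Unset Printing Implicit Defensive.

Import Order.TTheory GRing.Theory Num.Theory.
Import numFieldNormedType.Exports.

Local Open Scope classical_set_scope.
Local Open Scope ring_scope.

(** Let Z be the tensor product and let Y be a closed infinite-dimensional
    subspace of Z.  The proof is by induction on the number of factors and, for
    a given number, by contradiction: suppose that Y contains no complemented
    closed infinite-dimensional subspace.

    The tails of the decompositions are then almost the identity somewhere in
    Y.  If A is a bounded operator from Z to a subprojective space W and A is
    bounded below on some subspace Y' of Y, then a projection of W onto a
    subspace of A(Y') pulls back to a projection of Z onto a subspace of Y'
    ([pullback_complemented]).  Hence A is bounded below on no subspace of Y,
    and Kato's argument ([small_restriction]) finds inside every subspace of Y
    a further subspace where A has norm at most e, for any e > 0.  Operators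
    with this last property ([small_on]) are stable under sums and under
    composition on the left.  Let S_n be the n-th partial sum projection of the
    decomposition of a factor, and let Q_n be the tensor product of the
    operators 1 - S_n.  A telescoping sum ([small_on_telescope]) expresses
    1 - Q_n through operators that act as S_n on one factor and as the identity
    on the others.  Since S_n has finite rank, each of these is a sum of
    operators that factor through the tensor product of the remaining factors
    ([rank1_factor]), which is subprojective by induction.  So for every n some
    unit vector y of Y is as close to Q_n y as desired.

    A gliding hump ([block_argument]) now gives unit vectors y_j of Y that are
    very close to a block-diagonal sequence w_j = B_j u_j, where B_j is the
    tensor product of the projections onto the j-th blocks.  With functionals
    phi_j of norm one such that phi_j(w_j) = |w_j|, put
    g_j(z) = phi_j(B_j z) / |w_j|.  The operator R z = sum_j g_j(z) w_j is a
    projection onto the closed span of the w_j; it is bounded because, by the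
    E-estimate and the unconditionality of E, the norm of R z is controlled by
    that of sum_j B_j z, and the operators sum_(j < J) B_j are uniformly
    bounded, as is seen by averaging over signs ([diagonal_bound]).  Finally
    z + sum_j g_j(z) (y_j - w_j) defines an invertible operator that maps w_j to
    y_j, so the closed span of the y_j, a subspace of Y, is complemented
    ([perturbed_complemented]): a contradiction.

    Norms take their values in the scalar field, which is only partially
    ordered when it is the field of complex numbers.  Two facts distinguish the
    scalars from those of an arbitrary number field: norming functionals exist
    (Hahn-Banach), and 2^-n tends to 0. *)

(** * The Hahn-Banach theorem, real and complex *)

Section HahnBanachReal.
Variables (R : realType) (V : lmodType R) (p : V -> R).
Hypothesis pD : forall x y, p (x + y) <= p x + p y.
Hypothesis pZ : forall a x, p (a *: x) = `|a| * p x.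

Let p0 : p 0 = 0.
Proof. by rewrite -(scale0r 0) pZ normr0 mul0r. Qed.

Let pN x : p (- x) = p x.
Proof. by rewrite -scaleN1r pZ normrN1 mul1r. Qed.

Let p_ge0 x : 0 <= p x.
Proof.
by have := pD x (- x); rewrite subrr p0 pN -mulr2n pmulrn_lge0.
Qed.

(** Partial functionals are represented by their graphs, so that the union of a
    chain of them is a plain union of sets. *)
Definition dominated_graph (w : V) (G : set (V * R)) : Prop :=
  [/\ G (w, p w), forall a u v, G u -> G v -> G (a *: u.1 + v.1, a * u.2 + v.2) &
      forall u, G u -> u.2 <= p u.1].

(** One-dimensional extension: the value c at x has to separate the numbers
    f(u) - p(u - x) from the numbers p(v + x) - f(v), and subadditivity of p says
    that the former lie below the latter. *)
Lemma dominated_graph_extend w G x : dominated_graph w G ->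
  exists c, forall a u, G u -> u.2 + a * c <= p (u.1 + a *: x).
Proof.
move=> [Gw Glin Gp].
have G0 : G (0, 0).
  have /= := Glin (-1) _ _ Gw Gw.
  by rewrite scaleN1r mulN1r !addNr.
have GZ a u : G u -> G (a *: u.1, a * u.2).
  by move=> Gu; have /= := Glin a _ _ Gu G0; rewrite !addr0.
have key u v : G u -> G v -> u.2 - p (u.1 - x) <= p (v.1 + x) - v.2.
  move=> Gu Gv; rewrite lerBrDr addrAC lerBlDr.
  have /Gp/= := Glin 1 _ _ Gu Gv; rewrite scale1r mul1r => /le_trans; apply.
  have -> : u.1 + v.1 = (v.1 + x) + (u.1 - x) by rewrite addrACA subrr addr0 addrC.
  exact: pD.
pose S := [set u.2 - p (u.1 - x) | u in G].
have S0 : has_sup S.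
  split; first by exists (0 - p (0 - x)); exists (0, 0).
  exists (p (0 + x) - 0) => _ [u Gu <-]; exact: (key u (0, 0)).
exists (sup S) => a u Gu.
have [->|a0] := eqVneq a 0; first by rewrite mul0r scale0r !addr0; apply: Gp.
have Ga := GZ a^-1 _ Gu.
have [apos|aneg] := ltP 0 a.
  have -> : u.1 + a *: x = a *: (a^-1 *: u.1 + x).
    by rewrite scalerDr scalerA mulfV// scale1r.
  rewrite pZ gtr0_norm// -ler_pdivrMl// mulrDr mulKf//.
  rewrite -lerBrDl; apply: ge_sup; first exact: S0.1.
  by move=> _ [v Gv <-]; exact: (key _ (_, _)).
have {}aneg : a < 0 by rewrite lt_neqAle a0.
have GNa := GZ (- a^-1) _ Gu.
have -> : u.1 + a *: x = (- a) *: ((- a^-1) *: u.1 - x).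
  by rewrite scalerBr scalerA mulrNN mulfV// scale1r scaleNr opprK.
have /= /(_ _ (imageP _ GNa)) /= := sup_upper_bound S0.
set q := p _; set y := sup S => H; rewrite pZ normrN ltr0_norm// -/q.
have na : 0 <= - a by rewrite oppr_ge0 ltW.
have := ler_wpM2l na H.
have -> : - a * (- a^-1 * u.2 - q) = u.2 - (- a * q) by field.
by lra.
Qed.

(** Zorn's lemma applied to dominated graphs.  The empty set is admitted among the
    graphs because the empty chain must have an upper bound; it is not maximal. *)
Lemma hahn_banach_real (w : V) : exists f : V -> R^o,
  [/\ linear f, f w = p w & forall x, f x <= p x].
Proof.
pose P : set (set (V * R)) := [set G | G = set0 \/ dominated_graph w G].
pose L : set (V * R) := [set (a *: w, a * p w) | a in setT].
have PL : dominated_graph w L.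
  split=> [|a _ _ [b _ <-] [c _ <-]|_ [b _ <-]]/=.
  - by exists 1 => //; rewrite scale1r mul1r.
  - by exists (a * b + c) => //; rewrite scalerDl mulrDl scalerA mulrA.
  - by rewrite pZ ler_wpM2r// ler_norm.
have [F FP Ftot|A [PA Amax]] := @Zorn_bigcup _ P.
  have [[G FG [u0 Gu0]]|F0] := pselect (exists2 G, F G & G !=set0); last first.
    left; rewrite -subset0 => u [G FG Gu]; apply: F0; exists G => //.
    by exists u.
  have ne G' u : F G' -> G' u -> dominated_graph w G'.
    by move=> /FP[->//|].
  right; split.
  - by exists G => //; have [] := ne _ _ FG Gu0.
  - move=> a u v [G1 FG1 u1] [G2 FG2 v2].
    have [S|S] := Ftot _ _ FG1 FG2.
      by exists G2 => //; have [_ H _] := ne _ _ FG2 v2; apply: H => //; apply: S.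
    by exists G1 => //; have [_ H _] := ne _ _ FG1 u1; apply: H => //; apply: S.
  - by move=> u [G1 FG1 u1]; have [_ _] := ne _ _ FG1 u1; apply.
have {PA}[A0|[Aw Alin Ap]] := PA.
  exfalso; apply: (Amax L); last by right.
  rewrite A0; split=> [//|/(_ (w, p w))]; apply.
  by case: PL.
have Atot x : exists r : R, A (x, r).
  apply: contrapT => Ax.
  have [c hc] := dominated_graph_extend x (And3 Aw Alin Ap).
  pose B : set (V * R) :=
    [set (z.1.1 + z.2 *: x, z.1.2 + z.2 * c) | z in [set z : (V * R) * R | A z.1]].
  have A00 : A (0, 0).
    by have /= := Alin (-1) _ _ Aw Aw; rewrite scaleN1r mulN1r !addNr.
  apply: (Amax B); last first.
    right; split=> [|a _ _ [[u r] /= Au <-] [[v s] /= Av <-]|_ [[u r] /= Au <-]].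
    - by exists ((w, p w), 0) => //=; rewrite scale0r mul0r !addr0.
    - exists ((a *: u.1 + v.1, a * u.2 + v.2), a * r + s) => /=; first exact: Alin.
      by congr (_, _); [rewrite scalerDr scalerDl scalerA addrACA|ring].
    - exact: hc.
  split=> [[u1 u2] Au|BA].
    by exists ((u1, u2), 0) => //=; rewrite scale0r mul0r !addr0.
  apply: Ax; exists c; apply: BA; exists ((0, 0), 1) => //=.
  by rewrite scale1r mul1r !add0r.
have [f hf] := choice Atot.
have Auniq x r s : A (x, r) -> A (x, s) -> r = s.
  move=> Ar As; apply/eqP; rewrite eq_le.
  have /Ap/= := Alin (-1) _ _ Ar As; have /Ap/= := Alin (-1) _ _ As Ar.
  by rewrite !scaleN1r !addNr p0 !mulN1r; lra.
exists f; split=> [a u v||x].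
- by apply: (Auniq (a *: u + v)) => //; exact: (Alin a _ _ (hf u) (hf v)).
- exact: (Auniq w).
- exact: (Ap _ (hf x)).
Qed.

End HahnBanachReal.

Section HahnBanachComplex.
Variable R : realType.

(** An alias, so that the real scalar multiplication does not compete with the
    complex one. *)
Definition realify (V : lmodType R[i]) : Type := V.
HB.instance Definition _ (V : lmodType R[i]) := GRing.Zmodule.on (realify V).
Variable V : lmodType R[i].
Let rscale (a : R) (x : realify V) : realify V := (a%:C)%C *: (x : V).
Let rscaleA a b x : rscale a (rscale b x) = rscale (a * b) x.
Proof. by rewrite /rscale scalerA rmorphM. Qed.
Let rscale1 : left_id 1 rscale.
Proof. by move=> x; rewrite /rscale scale1r. Qed.
Let rscaleDr : right_distributive rscale +%R.
Proof. by move=> a x y; rewrite /rscale scalerDr. Qed.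
Let rscaleDl x : {morph rscale^~ x : a b / a + b}.
Proof. by move=> a b; rewrite /rscale rmorphD scalerDl. Qed.
HB.instance Definition _ := GRing.Zmodule_isLmodule.Build R (realify V)
  rscaleA rscale1 rscaleDr rscaleDl.
Lemma realify_scaleE (a : R) (x : realify V) : a *: x = (a%:C)%C *: (x : V) :> V.
Proof. by []. Qed.
End HahnBanachComplex.

(** The usual complexification: if f is a real functional dominated by the norm,
    then x |-> f(x) - i f(i x) is complex linear.  Its modulus at x is its value,
    hence that of f, at a unimodular multiple of x. *)
Lemma norming_complex (R : realType) (V : normedModType R[i]) (w : V) :
  exists f : V -> R[i]^o, [/\ linear f, f w = `|w| & forall x, `|f x| <= `|x|].
Proof.
have normC (x : V) : `|x| = (complex.Re `|x|)%:C%C.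
  by rewrite RRe_real// normr_real.
pose p (x : realify V) : R := complex.Re `|x : V|.
have pD (x y : realify V) : p (x + y) <= p x + p y.
  have := ler_normD (x : V) (y : V); rewrite (normC (_ + _)) (normC x) (normC y) -rmorphD.
  by rewrite lecR.
have pZ a (x : realify V) : p (a *: x) = `|a| * p x.
  rewrite /p realify_scaleE normrZ [X in _ * X]normC.
  by rewrite normc_def /= expr0n addr0 sqrtr_sqr mul0r subr0.
have [f [lf fw fp]] := hahn_banach_real pD pZ w.
pose F (x : V) : R[i]^o := (f x +i* - f ('i%C *: x))%C.
have fD x y : f (x + y) = f x + f y by have := lf 1 x y; rewrite !scale1r.
have fZ a x : f (a *: x) = a * f x.
  have f0 : f 0 = 0 by have := lf (-1) 0 0; rewrite !scaleN1r !addNr.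
  by have := lf a x 0; rewrite f0 !addr0.
have fC (b c : R) (x : V) :
    f ((b +i* c)%C *: x) = b * f x + c * f ('i%C *: x).
  have -> : (b +i* c)%C *: x = b *: (x : realify V) + c *: ('i%C *: x : realify V).
    transitivity ((b%:C)%C *: x + (c%:C * 'i)%C *: x); last by rewrite -scalerA.
    by rewrite -scalerDl; congr (_ *: _); simpc.
  by rewrite fD !fZ.
have lF : linear F.
  move=> [b c] x y; rewrite /F scalerDr scalerA [(b +i* c)%C *: F x]/GRing.scale/=.
  have -> : ('i * (b +i* c) = (- c) +i* b)%C by simpc.
  rewrite !fD (fC b c) (fC (- c) b);
  by simpc; congr (_ +i* _)%C; rewrite // [X in _ = X - _]addrC.
have Fb x : `|F x| <= `|x|.
  have [F0|F0] := eqVneq (F x) 0; first by rewrite F0 normr0.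
  pose l : R[i] := `|F x| / F x.
  have Fl : F (l *: x) = `|F x|.
    have := lF l x 0; have F00 : F 0 = 0.
      by have := lF (-1) 0 0; rewrite !scaleN1r !addNr.
    by rewrite F00 !addr0 => ->; rewrite /l /GRing.scale/= divfK.
  have nl : `|l| = 1 by rewrite normrM normfV normr_id mulfV// normr_eq0.
  have -> : `|x| = `|l *: x| by rewrite normrZ nl mul1r.
  rewrite -[leLHS]RRe_real ?normr_real// -Fl /= [leRHS]normC lecR.
  exact: fp.
exists F; split => //.
have := Fb w; rewrite normc_def [`|w|]normC lecR {1}/F /= fw -/(p w).
have pw : 0 <= p w by rewrite -lecR /p -normC; exact: normr_ge0.
rewrite -[leRHS]ger0_norm// -sqrtr_sqr ler_sqrt ?sqr_ge0//.
rewrite gerDl => H; rewrite /F fw; congr (_ +i* _)%C.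
by apply/eqP; rewrite -sqrf_eq0 eq_le H sqr_ge0.
Qed.

Section Scalars.
Context {K : numFieldType} (hK : real_or_complex K).

Lemma norming_functional (V : normedModType K) (w : V) :
  exists f : V -> K^o, [/\ linear f, f w = `|w| & forall x, `|f x| <= `|x|].
Proof.
move: V w; case: hK => R [->|->] V w; last exact: norming_complex.
have [|a x|f [lf fw fp]] := @hahn_banach_real R V (fun x => `|x|) _ _ w.
- exact: ler_normD.
- exact: normrZ.
exists f; split=> // x; rewrite ler_norml fp andbT.
have f0 : f 0 = 0 by have := lf (-1) 0 0; rewrite !scaleN1r !addNr.
have := lf (-1) x 0; rewrite f0 !addr0 !scaleN1r => fN.
by rewrite lerNl -fN -(normrN x); apply: fp.
Qed.

Lemma dyadic_small (e : K) : 0 < e -> exists n, 2^-1 ^+ n <= e.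
Proof.
have real (R : realType) (r : R) : 0 < r -> exists n, 2^-1 ^+ n <= r.
  move=> r0; have [n rn] : exists n, r^-1 < n%:R.
    by exists (Num.truncn r^-1).+1; exact: truncnS_gt.
  exists n; rewrite exprVn -[leRHS]invrK lef_pV2 ?posrE ?invr_gt0 ?exprn_gt0//.
  apply: (le_trans (ltW rn)); rewrite -natrX ler_nat.
  by apply: ltnW; rewrite ltn_expl.
move: e; case: hK => R [->|->] e; first exact: real.
move=> e0; have eE : e = (complex.Re e)%:C%C by rewrite RRe_real// gtr0_real.
have : 0 < complex.Re e by rewrite -ltcR -eE.
move=> /real[n hn]; exists n; rewrite eE; move: hn; rewrite -lecR.
by rewrite rmorphXn/= fmorphV rmorph_nat.
Qed.

End Scalars.

(** * Linear maps, subspaces and infinite dimension *)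

Section LinearMaps.
Context {K : numFieldType}.
Implicit Types V W : lmodType K.

(** Operators are handled as plain functions together with a proof of linearity,
    because those obtained by choice come without a bundled structure. *)
Definition lin_pack V W (f : V -> W) (lf : linear f) : {linear V -> W} :=
  HB.pack f (GRing.isLinear.Build K V W *:%R f lf).

Section Rules.
Variables (V W : lmodType K) (f : V -> W) (lf : linear f).
Lemma lin0 : f 0 = 0. Proof. exact: (linear0 (lin_pack lf)). Qed.
Lemma linD x y : f (x + y) = f x + f y.
Proof. exact: (linearD (lin_pack lf)). Qed.
Lemma linN x : f (- x) = - f x.
Proof. exact: (linearN (lin_pack lf)). Qed.
Lemma linB x y : f (x - y) = f x - f y.
Proof. exact: (linearB (lin_pack lf)). Qed.
Lemma linZ a x : f (a *: x) = a *: f x.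
Proof. exact: (linearZZ (lin_pack lf)). Qed.
Lemma lin_sum I (r : seq I) (P : pred I) (x : I -> V) :
  f (\sum_(i <- r | P i) x i) = \sum_(i <- r | P i) f (x i).
Proof. exact: (linear_sum (lin_pack lf)). Qed.
End Rules.

Lemma linear_comp V1 V2 V3 (f : V2 -> V3) (g : V1 -> V2) :
  linear f -> linear g -> linear (fun x => f (g x)).
Proof. by move=> lf lg a u v; rewrite lg lf. Qed.
Lemma linear_id V : linear (@id V). Proof. by []. Qed.
Lemma linear_cst0 V W : linear (fun _ : V => 0 : W).
Proof. by move=> a u v; rewrite scaler0 addr0. Qed.
Lemma linear_add V W (f g : V -> W) :
  linear f -> linear g -> linear (fun x => f x + g x).
Proof. by move=> lf lg a u v; rewrite lf lg scalerDr addrACA. Qed.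
Lemma linear_opp V W (f : V -> W) : linear f -> linear (fun x => - f x).
Proof. by move=> lf a u v; rewrite lf scalerN opprD. Qed.
Lemma linear_scale V W (f : V -> W) c : linear f -> linear (fun x => c *: f x).
Proof. by move=> lf a u v; rewrite lf scalerDr !scalerA mulrC. Qed.
Lemma linear_sumf V W I (r : seq I) (P : pred I) (f : I -> V -> W) :
  (forall i, linear (f i)) -> linear (fun x => \sum_(i <- r | P i) f i x).
Proof.
move=> lf a u v; rewrite scaler_sumr -big_split/=.
by apply: eq_bigr => i _; rewrite lf.
Qed.
Lemma linear_rank1 V W (f : V -> K^o) (e : W) :
  linear f -> linear (fun x => (f x : K) *: e).
Proof. by move=> lf a u v; rewrite lf scalerDl scalerA. Qed.

Section Subspaces.
Variables (V : lmodType K) (A : set V) (sA : lin_subspace A).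
Lemma subspace0 : A 0. Proof. exact: sA.1. Qed.
Lemma subspaceD x y : A x -> A y -> A (x + y).
Proof. by move=> Ax Ay; rewrite -[x]scale1r; apply: sA.2. Qed.
Lemma subspaceZ a x : A x -> A (a *: x).
Proof. by move=> Ax; rewrite -[_ *: _]addr0; apply: sA.2 => //; exact: subspace0. Qed.
Lemma subspaceB x y : A x -> A y -> A (x - y).
Proof. by move=> Ax Ay; apply: subspaceD => //; rewrite -scaleN1r; apply: subspaceZ. Qed.
Lemma subspace_sum I (r : seq I) (P : pred I) (x : I -> V) :
  (forall i, P i -> A (x i)) -> A (\sum_(i <- r | P i) x i).
Proof. by move=> Ax; elim/big_ind: _ => //; [exact: subspace0|exact: subspaceD]. Qed.
End Subspaces.

Lemma lin_span_min V (A B : set V) :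
  A `<=` B -> lin_subspace B -> lin_span A `<=` B.
Proof.
move=> AB sB x [n [c [v [Av ->]]]]; apply: subspace_sum => // i _.
by apply: subspaceZ => //; apply: AB.
Qed.

Lemma lin_span_sub V (A : set V) : A `<=` lin_span A.
Proof.
move=> x Ax; exists 1%N, (fun=> 1), (fun=> x); split => //.
by rewrite big_ord1 scale1r.
Qed.

Lemma lin_span_subspace V (A : set V) : lin_subspace (lin_span A).
Proof.
split.
  by exists 0%N, (fun=> 0), (fun=> 0); split; [case|rewrite big_ord0].
move=> a u v [n [c [x [Ax ->]]]] [m [d [y [Ay ->]]]].
exists (n + m)%N, (fun i => match fintype.split i with inl j => a * c j | inr j => d j end),
  (fun i => match fintype.split i with inl j => x j | inr j => y j end); split.
  by move=> i; case: (fintype.split i).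
rewrite big_split_ord/= scaler_sumr; congr (_ + _); apply: eq_bigr => i _.
  by rewrite -[lshift _ _]/(unsplit (inl i)) unsplitK scalerA.
by rewrite -[rshift _ _]/(unsplit (inr i)) unsplitK.
Qed.

Lemma lin_subspaceI V (A B : set V) :
  lin_subspace A -> lin_subspace B -> lin_subspace (A `&` B).
Proof.
move=> sA sB; split; first by split; apply: subspace0.
by move=> a u v [Au Bu] [Av Bv]; split; [exact: sA.2|exact: sB.2].
Qed.

Lemma lin_subspace_preim V W (f : V -> W) (B : set W) :
  linear f -> lin_subspace B -> lin_subspace (f @^-1` B).
Proof.
move=> lf sB; split=> [|a u v]; rewrite /preimage/=.
  by rewrite (lin0 lf); apply: subspace0.
by rewrite lf; exact: sB.2.
Qed.

Lemma lin_subspace_image V W (f : V -> W) (A : set V) :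
  linear f -> lin_subspace A -> lin_subspace (f @` A).
Proof.
move=> lf sA; split; first by exists 0; [exact: subspace0|exact: lin0].
move=> a _ _ [u Au <-] [v Av <-]; exists (a *: u + v); [exact: sA.2|exact: lf].
Qed.

Lemma lin_subspace_set0 V : lin_subspace [set (0 : V)].
Proof. by split=> // a u v -> ->; rewrite scaler0 addr0. Qed.

Lemma finite_dim_seq V (A : set V) : finite_dim A ->
  exists s : seq V, forall x, A x -> exists c : nat -> K,
    x = \sum_(i < size s) c i *: s`_i.
Proof.
case=> F /finite_seqP[s ->] AF; exists s => x /AF; move: x.
apply: lin_span_min.
  move=> x /= xs; exists (fun i => (i == index x s)%:R).
  have ltx : (index x s < size s)%N by rewrite index_mem.
  rewrite (bigD1 (Ordinal ltx))//= eqxx scale1r nth_index// big1 ?addr0// => i.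
  by rewrite -val_eqE/= => /negPf->; rewrite scale0r.
split; first by exists (fun=> 0); rewrite big1// => i _; rewrite scale0r.
move=> a _ _ [c ->] [d ->]; exists (fun i => a * c i + d i).
rewrite scaler_sumr -big_split; apply: eq_bigr => i _ /=.
by rewrite scalerDl scalerA.
Qed.

(** Infinite dimension is accessed through independent families of every finite
    length: their images under injective linear maps and their liftings along linear maps are
    again independent, whereas a finite spanning set need not lie in A. *)
Definition independent V n (v : nat -> V) := forall c : nat -> K,
  \sum_(i < n) c i *: v i = 0 -> forall i, (i < n)%N -> c i = 0.

(** The coefficients of n vectors on a spanning list of length less than n form a
    matrix with more rows than columns, whose left kernel is not zero. *)
Lemma independent_bound V (s : seq V) n (v : nat -> V) :
  (forall i, (i < n)%N -> exists c : nat -> K, v i = \sum_(j < size s) c j *: s`_j) ->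
  independent n v -> (n <= size s)%N.
Proof.
move=> vs iv; rewrite leqNgt; apply/negP => sn.
have /choice[c hc] : forall i : 'I_n, exists c : nat -> K,
    v i = \sum_(j < size s) c j *: s`_j by move=> i; apply: vs.
pose M := \matrix_(i < n, j < size s) c i j.
have : kermx M != 0.
  rewrite -mxrank_eq0 mxrank_ker -lt0n subn_gt0.
  exact: leq_ltn_trans (rank_leq_col _) sn.
case/rowV0Pn => a /sub_kermxP aM a0.
pose b k := if insub k is Some i then a ord0 (i : 'I_n) else 0.
have bE (i : 'I_n) : b i = a ord0 i by rewrite /b valK.
suff b0 : forall i, (i < n)%N -> b i = 0.
  case/eqP: a0; apply/rowP => i; rewrite mxE -bE; exact: b0.
apply: iv; under eq_bigr => i _ do rewrite hc scaler_sumr.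
rewrite exchange_big big1// => j _ /=.
under eq_bigr => i _ do rewrite scalerA.
rewrite -scaler_suml; have /rowP/(_ j) := aM; rewrite !mxE => aMj.
rewrite (eq_bigr (fun i => a ord0 i * M i j)) ?aMj ?scale0r// => i _.
by rewrite bE mxE.
Qed.

Lemma independent_infinite_dim V (A : set V) :
  (forall n, exists2 v : nat -> V, forall i, (i < n)%N -> A (v i) & independent n v) ->
  infinite_dim A.
Proof.
move=> H /finite_dim_seq[s hs].
have [v Av iv] := H (size s).+1.
have := independent_bound (fun i ltin => hs _ (Av i ltin)) iv.
by rewrite ltnn.
Qed.

(** Otherwise the vectors already chosen would span A. *)
Lemma infinite_dim_independent V (A : set V) n : infinite_dim A ->
  exists2 v : nat -> V, forall i, (i < n)%N -> A (v i) & independent n v.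
Proof.
move=> iA; elim: n => [|n [v Av iv]]; first by exists (fun=> 0).
pose F := [set v i | i in `I_n].
have [x [Ax Fx]] : exists x, A x /\ ~ lin_span F x.
  apply: contrapT => H; apply: iA; exists F.
    by apply: finite_image; exact: finite_II.
  by move=> x Ax; apply: contrapT => Fx; apply: H; exists x.
pose w i := if (i < n)%N then v i else x.
exists w => [i _|c].
  by rewrite /w; case: ifPn => // /Av.
rewrite big_ord_recr/= {2}/w ltnn.
under eq_bigr => i _ do rewrite /w ltn_ord.
move=> c0; have cn : c n = 0.
  apply: contrapT => /eqP cn; apply: Fx.
  have -> : x = - (c n)^-1 *: (\sum_(i < n) c i *: v i).
    move/eqP: c0; rewrite addr_eq0 => /eqP->.
    by rewrite scalerN scaleNr opprK scalerA mulVf// scale1r.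
  apply: subspaceZ; first exact: lin_span_subspace.
  apply: subspace_sum; first exact: lin_span_subspace.
  move=> i _; apply: subspaceZ; first exact: lin_span_subspace.
  by apply: lin_span_sub; exists i => //=.
move=> i; rewrite ltnS leq_eqVlt => /orP[/eqP->//|]; apply: iv.
by move: c0; rewrite cn scale0r addr0.
Qed.

(** By induction on i, the functional h i isolates the i-th coefficient. *)
Lemma independent_triangular V (v : nat -> V) (h : nat -> V -> K^o) n :
  (forall i, linear (h i)) -> (forall i, h i (v i) = 1) ->
  (forall i j, (i < j)%N -> h i (v j) = 0) -> independent n v.
Proof.
move=> lh h1 h0 c c0; suff H : forall m i, (i < m)%N -> (i < n)%N -> c i = 0.
  by move=> i; exact: H (ltnSn i).
elim=> // m IH i; rewrite ltnS leq_eqVlt => /orP[/eqP->{i} mn|]; last exact: IH.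
have := congr1 (h m) c0; rewrite (lin0 (lh m)) (lin_sum (lh m)).
rewrite (bigD1 (Ordinal mn))//= big1 ?addr0.
  by rewrite (linZ (lh m)) h1 /GRing.scale/= mulr1.
move=> i; rewrite -val_eqE/= neq_ltn (linZ (lh m)) => /orP[im|mi].
  by rewrite IH// scale0r.
by rewrite h0// scaler0.
Qed.

Lemma independent_inj V W (f : V -> W) (A : set V) n v :
  lin_subspace A -> linear f -> (forall x, A x -> f x = 0 -> x = 0) ->
  (forall i, (i < n)%N -> A (v i)) -> independent n v ->
  independent n (fun i => f (v i)).
Proof.
move=> sA lf fA Av iv c; under eq_bigr => i _ do rewrite -(linZ lf).
rewrite -(lin_sum lf) => /fA H; apply: iv; apply: H.
by apply: subspace_sum => // i _; apply: subspaceZ => //; apply: Av.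
Qed.

Lemma independent_image V W (f : V -> W) n v :
  linear f -> independent n (fun i => f (v i)) -> independent n v.
Proof.
move=> lf iv c c0; apply: iv; rewrite -[RHS](lin0 lf) -c0 (lin_sum lf).
by apply: eq_bigr => i _; rewrite (linZ lf).
Qed.

(** One vector outside the kernel of f is enough to recover all of A from the
    hyperplane. *)
Lemma infinite_dim_hyperplane V (A : set V) (f : V -> K^o) :
  lin_subspace A -> linear f -> infinite_dim A ->
  infinite_dim (A `&` [set x | f x = 0]).
Proof.
move=> sA lf iA [F fF AF]; apply: iA.
have [[y [Ay fy]]|H] := pselect (exists y, A y /\ f y <> 0); last first.
  exists F => // x Ax; apply: AF; split => //=; apply: contrapT => fx.
  by apply: H; exists x.
exists (F `|` [set y]); first by rewrite finite_setU; split.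
move=> x Ax; have -> : x = (f x / f y : K) *: y + (x - (f x / f y : K) *: y).
  by rewrite addrC subrK.
apply: (lin_span_subspace _).2; first by apply: lin_span_sub; right.
have : lin_span F (x - (f x / f y : K) *: y).
  apply: AF; split=> /=; first by apply: subspaceB => //; apply: subspaceZ.
  by rewrite (linB lf) (linZ lf) /GRing.scale/= divfK ?subrr//; apply/eqP.
apply: lin_span_min; last exact: lin_span_subspace.
by move=> z Fz; apply: lin_span_sub; left.
Qed.

End LinearMaps.

(** * Bounded operators, closed sets and sequences *)

Section Norms.
Context {K : numFieldType}.

Definition bounded_op (X Y : normedModType K) (f : X -> Y) : Prop :=
  linear f /\ exists M, norm_bounded_by f M.

Lemma bounded_op_gt0 (X Y : normedModType K) (f : X -> Y) : bounded_op f ->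
  exists2 M, 0 < M & forall x, `|f x| <= M * `|x|.
Proof.
case=> _ [M [M0 fM]]; exists (M + 1); first by rewrite ltr_wpDl.
by move=> x; rewrite (le_trans (fM x))// ler_wpM2r// lerDl.
Qed.

Lemma norm_bounded_by_comp (X Y Z : normedModType K) (f : Y -> Z) (g : X -> Y) M N :
  norm_bounded_by f M -> norm_bounded_by g N ->
  norm_bounded_by (fun x => f (g x)) (M * N).
Proof.
move=> [M0 fM] [N0 gN]; split; first exact: mulr_ge0.
by move=> x; rewrite (le_trans (fM _))// -mulrA ler_wpM2l.
Qed.

Lemma norm_bounded_by_add (X Y : normedModType K) (f g : X -> Y) M N :
  norm_bounded_by f M -> norm_bounded_by g N ->
  norm_bounded_by (fun x => f x + g x) (M + N).
Proof.
move=> [M0 fM] [N0 gN]; split; first exact: addr_ge0.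
by move=> x; rewrite (le_trans (ler_normD _ _))// mulrDl lerD.
Qed.

Lemma norm_bounded_by_opp (X Y : normedModType K) (f : X -> Y) M :
  norm_bounded_by f M -> norm_bounded_by (fun x => - f x) M.
Proof. by move=> [M0 fM]; split=> // x; rewrite normrN. Qed.

Lemma norm_bounded_by_id (X : normedModType K) : norm_bounded_by (@id X) 1.
Proof. by split=> // x; rewrite mul1r. Qed.

Lemma norm_bounded_byW (X Y : normedModType K) (f : X -> Y) M N :
  M <= N -> norm_bounded_by f M -> norm_bounded_by f N.
Proof.
move=> MN [M0 fM]; split; first exact: le_trans MN.
by move=> x; rewrite (le_trans (fM x))// ler_wpM2r.
Qed.

Lemma bounded_op_comp (X Y Z : normedModType K) (f : Y -> Z) (g : X -> Y) :
  bounded_op f -> bounded_op g -> bounded_op (fun x => f (g x)).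
Proof.
move=> [lf [M fM]] [lg [N gN]]; split; first exact: linear_comp.
by exists (M * N); apply: norm_bounded_by_comp.
Qed.

Lemma bounded_op_id (X : normedModType K) : bounded_op (@id X).
Proof. by split=> //; exists 1; apply: norm_bounded_by_id. Qed.

Lemma bounded_op0 (X Y : normedModType K) : bounded_op (fun _ : X => 0 : Y).
Proof.
split; first exact: linear_cst0.
by exists 0; split=> // x; rewrite normr0 mul0r.
Qed.

Lemma bounded_op_add (X Y : normedModType K) (f g : X -> Y) :
  bounded_op f -> bounded_op g -> bounded_op (fun x => f x + g x).
Proof.
move=> [lf [M fM]] [lg [N gN]]; split; first exact: linear_add.
by exists (M + N); apply: norm_bounded_by_add.
Qed.

Lemma bounded_op_opp (X Y : normedModType K) (f : X -> Y) :
  bounded_op f -> bounded_op (fun x => - f x).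
Proof.
move=> [lf [M fM]]; split; first exact: linear_opp.
by exists M; apply: norm_bounded_by_opp.
Qed.

Lemma bounded_op_sub (X Y : normedModType K) (f g : X -> Y) :
  bounded_op f -> bounded_op g -> bounded_op (fun x => f x - g x).
Proof. by move=> bf bg; apply: bounded_op_add => //; apply: bounded_op_opp. Qed.

Lemma bounded_op_scale (X Y : normedModType K) (f : X -> Y) c :
  bounded_op f -> bounded_op (fun x => c *: f x).
Proof.
move=> [lf [M [M0 fM]]]; split; first exact: linear_scale.
exists (`|c| * M); split=> [|x]; first by rewrite mulr_ge0.
by rewrite normrZ -mulrA ler_wpM2l.
Qed.

Lemma bounded_op_sum (X Y : normedModType K) I (r : seq I) (P : pred I) (f : I -> X -> Y) :
  (forall i, bounded_op (f i)) -> bounded_op (fun x => \sum_(i <- r | P i) f i x).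
Proof.
move=> bf; elim: r => [|i r IH].
  by under eq_fun do rewrite big_nil; exact: bounded_op0.
under eq_fun do rewrite big_cons; case: (P i) => //.
exact: bounded_op_add.
Qed.

Lemma bounded_op_rank1 (X Y : normedModType K) (f : X -> K^o) (e : Y) :
  bounded_op f -> bounded_op (fun x => (f x : K) *: e).
Proof.
move=> [lf [M [M0 fM]]]; split; first exact: linear_rank1.
exists (M * `|e|); split=> [|x]; first by rewrite mulr_ge0.
by rewrite normrZ mulrAC ler_wpM2r.
Qed.

Lemma bounded_op_continuous (X Y : normedModType K) (f : X -> Y) : bounded_op f -> continuous f.
Proof.
move=> bf; have [M M0 fM] := bounded_op_gt0 bf; move=> x; apply/cvgrPdist_le => e e0.
have : \forall y \near x, `|x - y| <= e / M by apply: cvgr_dist_le => //; rewrite divr_gt0.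
apply: filterS => y; rewrite ler_pdivlMr// mulrC => H.
by rewrite -(linB bf.1) (le_trans (fM _)).
Qed.

Lemma continuous_bounded_op (X Y : normedModType K) (f : X -> Y) :
  linear f -> continuous f -> bounded_op f.
Proof.
move=> lf cf; split=> //.
have cf' : continuous (lin_pack lf) := cf.
have bf := (linear_bounded_continuous (lin_pack lf)).2 cf'.
have [M M0 fM] := pinfty_ex_gt0 ((linear_boundedP (lin_pack lf)).1 bf).
exists M; split; [exact: ltW|exact: fM].
Qed.

Lemma linear_isomorphism_bounded_op (X Y : normedModType K) (J : {linear X -> Y}) :
  isomorphism J -> bounded_op J /\ exists2 J' : Y -> X, bounded_op J' & cancel J J' /\ cancel J' J.
Proof.
move=> [cJ [J' [cJ' JJ' J'J]]]; split.
  by apply: continuous_bounded_op => //; exact: linearP.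
exists J' => //; apply: continuous_bounded_op => // a u v.
by apply: (can_inj JJ'); rewrite linearP !J'J.
Qed.

Lemma closureP (X : normedModType K) (A : set X) x :
  closure A x <-> forall e, 0 < e -> exists2 a, A a & `|x - a| <= e.
Proof.
split=> [clA e e0|H B /nbhs_ballP[e e0 eB]].
  have [|a [Aa xa]] := clA (ball x e); first exact: nbhsx_ballx.
  by exists a => //; move: xa; rewrite -ball_normE => /ltW.
have [|a Aa xa] := H (e / 2); first by rewrite divr_gt0.
exists a; split=> //; apply: eB; rewrite -ball_normE /=.
by rewrite (le_lt_trans xa)// ltr_pdivrMr// ltr_pMr// ltrDl.
Qed.

Lemma closedP (X : normedModType K) (A : set X) :
  closed A <-> forall x, (forall e, 0 < e -> exists2 a, A a & `|x - a| <= e) -> A x.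
Proof.
split=> H x; first by move/closureP/H.
by move=> /closureP; apply: H.
Qed.

Lemma closed_preim (X Y : normedModType K) (f : X -> Y) (B : set Y) :
  bounded_op f -> closed B -> closed (f @^-1` B).
Proof.
move=> bf /closedP cB; apply/closedP => x H; apply: cB => e e0.
have [M M0 fM] := bounded_op_gt0 bf.
have [|a Ba xa] := H (e / M); first by rewrite divr_gt0.
exists (f a) => //; rewrite -(linB bf.1) (le_trans (fM _))//.
by rewrite mulrC -ler_pdivlMr.
Qed.

Lemma closed_eq0 (X Y : normedModType K) (f : X -> Y) :
  bounded_op f -> closed [set x | f x = 0].
Proof.
move=> bf; apply: (@closed_preim _ _ _ [set 0]) => //.
apply/closedP => y H; apply/eqP; rewrite -normr_le0.
apply/ler_addgt0Pr => e e0; have [_ ->] := H e e0.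
by rewrite subr0 add0r.
Qed.

(** Used to extend operator bounds from a dense set. *)
Lemma closed_norm_le (X Y Z : normedModType K) (f : X -> Y) (g : X -> Z) c :
  0 <= c -> bounded_op f -> bounded_op g -> closed [set x | `|f x| <= c * `|g x|].
Proof.
move=> c0 bf bg; apply/closedP => x H /=; apply/ler_addgt0Pr => e e0.
have [M M0 fM] := bounded_op_gt0 bf; have [N N0 gN] := bounded_op_gt0 bg.
have MN : 0 < M + c * N by rewrite ltr_pwDl// mulr_ge0// ltW.
have [|a /= Ba xa] := H (e / (M + c * N)); first by rewrite divr_gt0.
rewrite -[x in f x](subrK a) (linD bf.1) (le_trans (ler_normD _ _))//.
have -> : `|g x| = `|g a - g (a - x)| by rewrite -(linB bg.1) subKr.
have Hg : `|g a| <= `|g a - g (a - x)| + N * `|x - a|.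
  rewrite -[g a in leLHS](subrK (g (a - x))) (le_trans (ler_normD _ _))// lerD2l.
  by rewrite distrC.
apply: (@le_trans _ _ (M * `|x - a| + c * (`|g a - g (a - x)| + N * `|x - a|))).
  by apply: lerD => //; rewrite (le_trans Ba)// ler_wpM2l.
rewrite mulrDr addrCA lerD2l mulrA -mulrDl.
by rewrite mulrC -ler_pdivlMr.
Qed.

Lemma closure_subspace (X : normedModType K) (A : set X) :
  lin_subspace A -> lin_subspace (closure A).
Proof.
move=> sA; split; first by apply: subset_closure; exact: subspace0.
move=> a u v /closureP Au /closureP Av; apply/closureP => e e0.
have a1 : 0 < `|a| + 1 by rewrite ltr_wpDl.
have [|u' Au' uu] := Au (e / (`|a| + 1) / 2); first by rewrite !divr_gt0.
have [|v' Av' vv] := Av (e / 2); first by rewrite divr_gt0.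
exists (a *: u' + v'); first exact: sA.2.
rewrite opprD addrACA -scalerBr (le_trans (ler_normD _ _))// [leRHS]splitr lerD//.
rewrite normrZ (@le_trans _ _ ((`|a| + 1) * `|u - u'|))//.
  by rewrite ler_wpM2r// lerDl.
by rewrite mulrC -ler_pdivlMr// mulrAC.
Qed.

(** The e-N form of convergence, equivalent to the filter one by
    [converges_cvg]. *)
Definition converges (X : normedModType K) (u : nat -> X) (x : X) : Prop :=
  forall e, 0 < e -> exists N, forall n, (N <= n)%N -> `|x - u n| <= e.

Lemma converges_cvg (X : normedModType K) (u : nat -> X) (x : X) :
  u @ \oo --> x <-> converges u x.
Proof.
split=> [/cvgrPdist_le H e e0|H].
  by have [N _ HN] := H e e0; exists N => n Nn; apply: HN.
by apply/cvgrPdist_le => e e0; have [N HN] := H e e0; exists N.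
Qed.

Lemma converges_bounded_op (X Y : normedModType K) (f : X -> Y) u x :
  bounded_op f -> converges u x -> converges (fun n => f (u n)) (f x).
Proof.
move=> bf ux e e0; have [M M0 fM] := bounded_op_gt0 bf.
have [|N HN] := ux (e / M); first by rewrite divr_gt0.
exists N => n /HN; rewrite ler_pdivlMr// mulrC => H.
by rewrite -(linB bf.1) (le_trans (fM _)).
Qed.

Lemma converges_unique (X : normedModType K) (u : nat -> X) x y :
  converges u x -> converges u y -> x = y.
Proof.
move=> ux uy; apply/eqP; rewrite -subr_eq0 -normr_le0.
apply/ler_addgt0Pr => e e0; rewrite add0r [e]splitr.
have [|N1 H1] := ux (e / 2); first by rewrite divr_gt0.
have [|N2 H2] := uy (e / 2); first by rewrite divr_gt0.
rewrite (le_trans (ler_distD (u (maxn N1 N2)) _ _))// lerD ?H1 ?leq_maxl//.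
by rewrite distrC H2// leq_maxr.
Qed.

Lemma converges_closed (X : normedModType K) (A : set X) u x :
  closed A -> (forall n, A (u n)) -> converges u x -> A x.
Proof.
move=> /closedP cA Au ux; apply: cA => e /ux[N HN]; exists (u N) => //.
exact: HN.
Qed.

Lemma complete_converges (X : completeNormedModType K) (u : nat -> X) :
  (forall e, 0 < e -> exists N, forall n, (N <= n)%N -> `|u N - u n| <= e) ->
  exists x, converges u x.
Proof.
move=> H; have : cvg (u @ \oo).
  apply: cauchy_cvg; apply: cauchy_exP => e e0.
  have [|N HN] := H (e / 2); first by rewrite divr_gt0.
  exists (u N); exists N => // n /= /HN; rewrite -ball_normE /= => {}H.
  by rewrite (le_lt_trans H)// ltr_pdivrMr// ltr_pMr// ltrDl.
by move=> /cvg_ex[x ux]; exists x; apply/converges_cvg.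
Qed.

End Norms.

(** * Bounded below operators and strictly singular operators *)

Section Subprojectivity.
Context {K : numFieldType} (hK : real_or_complex K).

Lemma half_lt1 : (2^-1 : K) < 1. Proof. by rewrite invf_lt1// ltrDl. Qed.
Lemma half_gt0 : 0 < (2^-1 : K). Proof. by rewrite invr_gt0. Qed.
Lemma halfX_ge0 n : 0 <= (2^-1 ^+ n : K). Proof. by rewrite exprn_ge0// ltW// half_gt0. Qed.
Lemma halfX_gt0 n : 0 < (2^-1 ^+ n : K). Proof. by rewrite exprn_gt0// half_gt0. Qed.
Lemma halfX_le m n : (m <= n)%N -> (2^-1 ^+ n : K) <= 2^-1 ^+ m.
Proof. by move=> mn; apply: ler_wiXn2l => //; rewrite ltW// ?half_gt0 ?half_lt1. Qed.
Lemma halfXS n : (2^-1 ^+ n.+1 + 2^-1 ^+ n.+1 : K) = 2^-1 ^+ n.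
Proof. by rewrite exprS -mulrDl -[X in X + X]mul1r -splitr mul1r. Qed.
Lemma sum_halfX n : \sum_(i < n) (2^-1 ^+ i.+1 : K) = 1 - 2^-1 ^+ n.
Proof.
elim: n => [|n IH]; first by rewrite big_ord0 subrr.
by rewrite big_ord_recr/= IH -[in LHS]halfXS opprD -addrA addrNK.
Qed.
Lemma sum_halfX_le1 n : \sum_(i < n) (2^-1 ^+ i.+1 : K) <= 1.
Proof. by rewrite sum_halfX gerBl halfX_ge0. Qed.

Lemma dyadic_small_mul (C e : K) : 0 <= C -> 0 < e ->
  exists N, forall n, (N <= n)%N -> C * 2^-1 ^+ n <= e.
Proof.
move=> C0 e0; have C1 : 0 < C + 1 by rewrite ltr_wpDl.
have [|N HN] := dyadic_small hK (e := e / (C + 1)); first by rewrite divr_gt0.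
exists N => n Nn; rewrite (@le_trans _ _ ((C + 1) * 2^-1 ^+ n))//.
  by rewrite ler_wpM2r ?halfX_ge0// lerDl.
by rewrite mulrC -ler_pdivlMr// (le_trans _ HN)// halfX_le.
Qed.

Definition bounded_below (X W : normedModType K) (A : X -> W) (Y : set X) :=
  exists2 c, 0 < c & forall y, Y y -> c * `|y| <= `|A y|.

(** A Cauchy sequence in the image lifts to a Cauchy sequence because A is bounded
    below. *)
Lemma closed_inf_image (X : completeNormedModType K) (W : completeNormedModType K)
    (A : X -> W) (Y : set X) :
  bounded_op A -> closed_inf_subspace Y -> bounded_below A Y ->
  closed_inf_subspace (A @` Y).
Proof.
move=> bA [sY cY iY] [c c0 hc]; split.
- exact: lin_subspace_image bA.1 sY.
- apply/closedP => w Hw.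
  have /choice[y hy] : forall n, exists y, Y y /\ `|w - A y| <= 2^-1 ^+ n.
    move=> n; have [|_ [y Yy <-] H] := Hw (2^-1 ^+ n); first exact: halfX_gt0.
    by exists y.
  have Ay : converges (fun n => A (y n)) w.
    move=> e e0; have [N HN] := dyadic_small_mul ler01 e0.
    exists N => n /HN; rewrite mul1r; apply: le_trans; exact: (hy n).2.
  have [|x yx] := @complete_converges _ _ y.
    move=> e e0.
    have [|N HN] := dyadic_small_mul (ler0n K 2) (e := c * e); first by rewrite mulr_gt0.
    exists N => n Nn.
    rewrite -(ler_pM2l c0) (le_trans (hc _ _))//.
      by apply: subspaceB => //; [exact: (hy N).1|exact: (hy n).1].
    rewrite (linB bA.1) (le_trans _ (HN _ (leqnn N)))//.
    rewrite (le_trans (ler_distD w _ _))// mulr_natl mulr2n lerD//.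
      by rewrite distrC; exact: (hy N).2.
    by rewrite (le_trans (hy n).2)// halfX_le.
  exists x; first by apply: (converges_closed cY) yx => n; exact: (hy n).1.
  exact: converges_unique (converges_bounded_op bA yx) Ay.
- apply: independent_infinite_dim => n.
  have [v Yv iv] := infinite_dim_independent n iY.
  exists (fun i => A (v i)); first by move=> i /Yv; exists (v i).
  apply: independent_inj Yv iv => //; first exact: bA.1.
  move=> x Yx Ax; apply/eqP; rewrite -normr_le0 -(ler_pM2l c0) mulr0.
  by rewrite (le_trans (hc _ Yx))// Ax normr0.
Qed.

Lemma closed_range_projection (X : completeNormedModType K) (Q : X -> X) :
  bounded_op Q -> (forall x, Q (Q x) = Q x) -> closed (range Q).
Proof.
move=> bQ QQ; have -> : range Q = [set x | x - Q x = 0].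
  apply/seteqP; split=> x /=; first by move=> [y _ <-]; rewrite QQ subrr.
  by move=> /eqP; rewrite subr_eq0 => /eqP->; exists x.
apply: closed_eq0; apply: bounded_op_sub => //; exact: bounded_op_id.
Qed.

Lemma complementedI (X : completeNormedModType K) (Q : X -> X) (Z : set X) :
  bounded_op Q -> (forall x, Q (Q x) = Q x) -> range Q = Z -> complemented Z.
Proof.
by move=> bQ QQ QZ; exists (lin_pack bQ.1); split=> //; exact: bounded_op_continuous bQ.
Qed.

Lemma complementedE (X : completeNormedModType K) (Z : set X) :
  complemented Z -> exists Q : X -> X, [/\ bounded_op Q, forall x, Q (Q x) = Q x & range Q = Z].
Proof.
move=> [Q [cQ QQ QZ]]; exists Q; split=> //.
by apply: continuous_bounded_op => //; exact: linearP.
Qed.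

Definition has_complemented (X : completeNormedModType K) (Y : set X) : Prop :=
  exists Z : set X, [/\ closed_inf_subspace Z, Z `<=` Y & complemented Z].

(** If R projects W onto a subspace of A(Y), then x |-> (A restricted to Y)^-1 (R (A x))
    is a projection with range in Y. *)
Lemma pullback_complemented (X W : completeNormedModType K) (A : X -> W) (Y : set X) :
  subprojective W -> bounded_op A -> closed_inf_subspace Y -> bounded_below A Y ->
  has_complemented Y.
Proof.
move=> subW bA hY hb.
have [Z0 [hZ0 Z0AY /complementedE[R [bR RR RZ]]]] := subW _ (closed_inf_image bA hY hb).
have [sY cY iY] := hY; have [c c0 hc] := hb.
have Auniq x y : Y x -> Y y -> A x = A y -> x = y.
  move=> Yx Yy Axy; apply/eqP; rewrite -subr_eq0 -normr_le0 -(ler_pM2l c0) mulr0.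
  by rewrite (le_trans (hc _ (subspaceB sY Yx Yy)))// (linB bA.1) Axy subrr normr0.
have /choice[Q hQ] : forall x, exists y, Y y /\ A y = R (A x).
  move=> x; have : (A @` Y) (R (A x)) by apply: Z0AY; rewrite -RZ; exists (A x).
  by case=> y Yy <-; exists y.
have QY x : Y (Q x) := (hQ x).1.
have AQ x : A (Q x) = R (A x) := (hQ x).2.
have Qid y : Y y -> Z0 (A y) -> Q y = y.
  move=> Yy; rewrite -RZ => -[w _ wy]; apply: Auniq => //.
  by rewrite AQ -wy RR.
have bQ : bounded_op Q.
  split=> [a u v|].
    apply: Auniq => //; first exact: sY.2.
    by rewrite AQ !(bA.1, bR.1) !AQ.
  have [M M0 hM] := bounded_op_gt0 (bounded_op_comp bR bA).
  exists (c^-1 * M); split; first by rewrite mulr_ge0// ?invr_ge0 ltW.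
  by move=> x; rewrite -mulrA ler_pdivlMl// (le_trans (hc _ (QY x)))// AQ.
have rQ : range Q = Y `&` A @^-1` Z0.
  apply/seteqP; split=> [_ [x _ <-]|y [Yy Ay]]; last by exists y => //; exact: Qid.
  by split; [exact: QY|rewrite /preimage/= AQ -RZ; exists (A x)].
have QQ x : Q (Q x) = Q x.
  have : (Y `&` A @^-1` Z0) (Q x) by rewrite -rQ; exists x.
  by case=> ? ?; exact: Qid.
exists (Y `&` A @^-1` Z0); split.
- have [sZ cZ iZ] := hZ0; split.
  + apply: lin_subspaceI => //; apply: lin_subspace_preim => //; exact: bA.1.
  + by apply: closedI => //; exact: closed_preim.
  + apply: independent_infinite_dim => n.
    have [v Zv iv] := infinite_dim_independent n iZ.
    have /choice[y hy] : forall i, exists y, (i < n)%N -> Y y /\ A y = v i.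
      move=> i; case: (ltnP i n) => [iln|]; last by exists 0.
      by have [y Yy Ayv] := Z0AY _ (Zv i iln); exists y.
    exists y => [i iln|].
      by have [Yy Ayv] := hy i iln; split=> //; rewrite /preimage/= Ayv; exact: Zv.
    apply: (independent_image bA.1) => d Hd; apply: iv; rewrite -[RHS]Hd.
    by apply: eq_bigr => i _; rewrite (hy i _).2.
- by move=> y [].
- exact: (complementedI bQ QQ).
Qed.

Lemma closed_inf_hyperplane (X : completeNormedModType K) (Y : set X) (f : X -> K^o) :
  bounded_op f -> closed_inf_subspace Y -> closed_inf_subspace (Y `&` [set x | f x = 0]).
Proof.
move=> bf [sY cY iY]; split.
- apply: lin_subspaceI => //; split=> [|a u v]/=; first exact: (lin0 bf.1).
  by rewrite bf.1 => -> ->; rewrite scaler0 addr0.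
- by apply: closedI => //; exact: closed_eq0.
- exact: infinite_dim_hyperplane bf.1 iY.
Qed.

(** The functionals f are only triangular with respect to the vectors y, so the
    coefficients of z are bounded one after the other, with a constant that doubles
    at each step.  This replaces the uniform bound of a basic sequence. *)
Lemma triangular_coef_bound (X : normedModType K) (y : nat -> X) (f : nat -> X -> K^o)
   (c : nat -> K) n :
  (forall i, linear (f i)) -> (forall i x, `|f i x| <= `|x|) ->
  (forall i, `|y i| = 1) -> (forall i, f i (y i) = 1) ->
  (forall i j, (i < j)%N -> f i (y j) = 0) ->
  forall j, (j < n)%N -> `|c j| <= 2 ^+ j * `|\sum_(i < n) c i *: y i|.
Proof.
move=> lf bf y1 fy1 fy0 j jn; set z := \sum_(i < n) _.
have cE k : (k < n)%N -> f k z = c k + \sum_(i < k) c i * f k (y i).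
  move=> kn; rewrite (lin_sum (lf k)).
  under eq_bigr do rewrite (linZ (lf k)).
  rewrite -(big_mkord xpredT (fun i => c i *: f k (y i))).
  rewrite (big_cat_nat (n := k.+1))//= big_nat_recr//= [X in _ + X]big_nat_cond.
  rewrite [X in _ + X]big1 ?addr0 => [|i /andP[/andP[ki _] _]]; last first.
    by rewrite fy0// scaler0.
  by rewrite fy1 addrC big_mkord /GRing.scale/= mulr1.
have key : forall m k, (k < m)%N -> (k < n)%N -> `|c k| <= 2 ^+ k * `|z|.
  elim=> // m IH k; rewrite ltnS leq_eqVlt => /orP[/eqP->{k} mn|]; last exact: IH.
  have -> : c m = f m z - \sum_(i < m) c i * f m (y i) by rewrite cE// addrK.
  rewrite (le_trans (ler_normB _ _))//.
  have sumE : 2 ^+ m = 1 + \sum_(i < m) (2 ^+ i : K).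
    elim: m {IH mn} => [|m IHm]; first by rewrite big_ord0 addr0.
    by rewrite big_ord_recr/= addrA -IHm exprS mulr_natl mulr2n.
  rewrite sumE mulrDl mul1r lerD// mulr_suml (le_trans (ler_norm_sum _ _ _))//.
  apply: ler_sum => i _; rewrite normrM.
  rewrite (le_trans _ (IH i (ltn_ord i) (ltn_trans (ltn_ord i) mn)))//.
  by rewrite ler_piMr// (le_trans (bf _ _))// y1.
exact: key (ltnSn j) jn.
Qed.

(** Kato's theorem on strictly singular operators.  Vectors y_n are chosen one by
    one in the kernels of functionals that norm the previous ones, with |A y_n| at
    most e 4^-n / 2.  The factor 2^-n of this bound beats the growth of the
    coefficients in [triangular_coef_bound], and the other factor 2^-(n+1) makes the
    sum at most e |z| on the span of the y_n. *)
Lemma small_restriction (X W : completeNormedModType K) (A : X -> W) (Y : set X) (e : K) :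
  bounded_op A -> closed_inf_subspace Y -> 0 < e ->
  (forall Y', closed_inf_subspace Y' -> Y' `<=` Y -> ~ bounded_below A Y') ->
  exists Y', [/\ closed_inf_subspace Y', Y' `<=` Y & forall y, Y' y -> `|A y| <= e * `|y|].
Proof.
move=> bA hY e0 nb.
pose good (S : set X) := closed_inf_subspace S /\ S `<=` Y.
have step (n : nat) (S : set X) : exists q : X * (X -> K^o), good S ->
    [/\ S q.1, `|q.1| = 1, `|A q.1| <= e * (2^-1 ^+ n * 2^-1 ^+ n.+1),
       linear q.2 & q.2 q.1 = 1 /\ forall x, `|q.2 x| <= `|x|].
  have [[hS SY]|nS] := pselect (good S); last by exists (0, fun=> 0).
  have [y [Sy Ay]] : exists y, S y /\
      `|A y| < e * (2^-1 ^+ n * 2^-1 ^+ n.+1) * `|y|.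
    apply: contrapT => H; apply: (nb S hS SY).
    exists (e * (2^-1 ^+ n * 2^-1 ^+ n.+1)).
      by rewrite mulr_gt0// mulr_gt0// halfX_gt0.
    move=> y Sy; rewrite real_leNgt ?normr_real//; last first.
      by rewrite realM ?normr_real// gtr0_real// mulr_gt0// mulr_gt0// halfX_gt0.
    by apply/negP => H1; apply: H; exists y.
  have y0 : `|y| != 0.
    apply: contraTneq Ay => ->; rewrite mulr0 -real_leNgt ?normr_real//.
  pose y' := `|y|^-1 *: y.
  have ny' : `|y'| = 1 by rewrite normrZ normfV normr_id mulVf.
  have [f [lf fy fb]] := norming_functional hK y'.
  exists (y', f) => _ /=; split=> //; last by rewrite fy.
  - by apply: subspaceZ => //; case: hS.
  - rewrite (linZ bA.1) normrZ normfV normr_id ler_pdivrMl ?normr_gt0 -?normr_gt0//.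
      by rewrite mulrC ltW.
    by rewrite lt_neqAle eq_sym y0 /=.
have /choice[F hF] : forall nS : nat * set X, exists q : X * (X -> K^o), good nS.2 ->
    [/\ nS.2 q.1, `|q.1| = 1, `|A q.1| <= e * (2^-1 ^+ nS.1 * 2^-1 ^+ nS.1.+1),
       linear q.2 & q.2 q.1 = 1 /\ forall x, `|q.2 x| <= `|x|].
  by move=> [n S]; exact: step.
(* G n is the subspace left after n steps; the n-th vector is taken in G n. *)
pose G (n : nat) := nat_rect (fun=> set X) Y
  (fun n S => S `&` [set x | (F (n, S)).2 x = 0]) n.
have bfun (f : X -> K^o) : linear f -> (forall x, `|f x| <= `|x|) -> bounded_op f.
  by move=> lf fb; split=> //; exists 1; split=> // x; rewrite mul1r.
have gG n : good (G n).
  elim: n => [|n gn]; first by split.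
  have [_ _ _ lf [_ fb]] := hF (n, G n) gn; split=> /=.
    apply: closed_inf_hyperplane => //; [exact: bfun|exact: gn.1].
  by move=> x [/gn.2].
pose y n := (F (n, G n)).1; pose f n := (F (n, G n)).2.
have Gle i j : (i <= j)%N -> G j `<=` G i.
  by move=> /subnK<-; elim: (j - i)%N => //= k IH x [/IH].
have yG n : G n (y n) by have [] := hF (n, G n) (gG n).
have y1 n : `|y n| = 1 by have [] := hF (n, G n) (gG n).
have Ay n : `|A (y n)| <= e * (2^-1 ^+ n * 2^-1 ^+ n.+1) by have [] := hF (n, G n) (gG n).
have lf n : linear (f n) by have [] := hF (n, G n) (gG n).
have fy1 n : f n (y n) = 1 by have [_ _ _ _ []] := hF (n, G n) (gG n).
have fb n x : `|f n x| <= `|x|.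
  by have [_ _ _ _ [_ H]] := hF (n, G n) (gG n); exact: H.
have fy0 i j : (i < j)%N -> f i (y j) = 0.
  by move=> ij; have [] := Gle i.+1 j ij _ (yG j).
pose S : set X := [set x | exists n (c : nat -> K), x = \sum_(i < n) c i *: y i].
have S_ext n m (c : nat -> K) : (n <= m)%N -> \sum_(i < n) c i *: y i =
    \sum_(i < m) (if (i < n)%N then c i else 0) *: y i.
  move=> nm; rewrite (big_ord_widen m (fun i => c i *: y i))// big_mkcond/=.
  by apply: eq_bigr => i _; case: ifP => //; rewrite scale0r.
have sS : lin_subspace S.
  split; first by exists 0%N, (fun=> 0); rewrite big_ord0.
  move=> a _ _ [n [c ->]] [m [d ->]].
  exists (maxn n m), (fun i => a * (if (i < n)%N then c i else 0) +
                              (if (i < m)%N then d i else 0)).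
  rewrite (S_ext n (maxn n m)) ?leq_maxl// (S_ext m (maxn n m)) ?leq_maxr//.
  rewrite scaler_sumr -big_split/=; apply: eq_bigr => i _.
  by rewrite scalerDl scalerA.
have yS n : S (y n).
  exists n.+1, (fun i => (i == n)%:R); rewrite big_ord_recr/= eqxx scale1r.
  by rewrite big1 ?add0r// => i _; rewrite ltn_eqF ?scale0r.
have SY : S `<=` Y.
  move=> _ [n [c ->]]; have [sY _ _] := hY; apply: subspace_sum => // i _.
  by apply: subspaceZ => //; apply: (Gle 0%N i).
have AS x : S x -> `|A x| <= e * `|x|.
  move=> [n [c xE]].
  have cb : forall j, (j < n)%N -> `|c j| <= 2 ^+ j * `|x|.
    by rewrite xE; apply: triangular_coef_bound.
  rewrite {1}xE (lin_sum bA.1) (le_trans (ler_norm_sum _ _ _))//.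
  apply: (@le_trans _ _ (\sum_(i < n) e * `|x| * 2^-1 ^+ i.+1)).
    apply: ler_sum => i _; rewrite (linZ bA.1) normrZ.
    apply: (le_trans (ler_pM _ _ (cb i (ltn_ord i)) (Ay i))) => //.
    have -> : 2 ^+ i * `|x| * (e * (2^-1 ^+ i * 2^-1 ^+ i.+1)) =
       (2 ^+ i * 2^-1 ^+ i) * (e * `|x| * 2^-1 ^+ i.+1 : K) by ring.
    by rewrite -exprMn mulfV ?pnatr_eq0// expr1n mul1r.
  rewrite -mulr_sumr ler_piMr ?sum_halfX_le1// mulr_ge0// ltW//.
exists (closure S); split.
- split; [exact: closure_subspace|exact: closed_closure|].
  apply: independent_infinite_dim => n; exists y => [i _|].
    by apply: subset_closure.
  exact: (independent_triangular lf).
- have [_ cY _] := hY; apply: subset_trans (closure_subset SY) _.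
  by move: cY; rewrite closure_id => <-.
- move=> x; have := closure_subset (AS : S `<=` [set x | `|A x| <= e * `|id x|]).
  move=> /(_ x) H /H; apply: closed_norm_le => //; [exact: ltW|exact: bounded_op_id].
Qed.

(** Strict singularity on Y and on all of its subspaces, in the form that is stable
    under sums: it provides subspaces on which U is small, which can be nested. *)
Definition small_on (X W : completeNormedModType K) (Y : set X) (U : X -> W) : Prop :=
  forall Y' e, closed_inf_subspace Y' -> Y' `<=` Y -> 0 < e ->
  exists Y'', [/\ closed_inf_subspace Y'', Y'' `<=` Y' &
    forall y, Y'' y -> `|U y| <= e * `|y|].

(** If A were bounded below on some subspace of Y, that subspace would contain a
    complemented one by [pullback_complemented]. *)
Lemma small_on_subprojective (X W : completeNormedModType K) (Y : set X) (A : X -> W) :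
  subprojective W -> bounded_op A -> ~ has_complemented Y -> small_on Y A.
Proof.
move=> subW bA nY Y' e hY' Y'Y e0; apply: small_restriction => // Y2 hY2 Y2Y' hb.
apply: nY; have [Z [hZ ZY2 cZ]] := pullback_complemented subW bA hY2 hb.
by exists Z; split=> // x /ZY2/Y2Y'/Y'Y.
Qed.

Lemma small_on0 (X W : completeNormedModType K) (Y : set X) :
  small_on Y (fun _ => 0 : W).
Proof.
move=> Y' e hY' Y'Y e0; exists Y'; split=> // y _.
by rewrite normr0 mulr_ge0// ltW.
Qed.

Lemma small_on_add (X W : completeNormedModType K) (Y : set X) (U V : X -> W) :
  small_on Y U -> small_on Y V -> small_on Y (fun x => U x + V x).
Proof.
move=> sU sV Y' e hY' Y'Y e0; have e2 : 0 < e / 2 by rewrite divr_gt0.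
have [Y1 [hY1 Y1Y' hU]] := sU _ _ hY' Y'Y e2.
have [Y2 [hY2 Y2Y1 hV]] := sV _ _ hY1 (subset_trans Y1Y' Y'Y) e2.
exists Y2; split=> //; first exact: subset_trans Y2Y1 _.
move=> y Y2y; rewrite (le_trans (ler_normD _ _))// [e]splitr mulrDl.
by rewrite lerD ?hV// hU//; exact: Y2Y1.
Qed.

Lemma small_on_sum (X W : completeNormedModType K) (Y : set X) I (r : seq I)
    (U : I -> X -> W) :
  (forall i, small_on Y (U i)) -> small_on Y (fun x => \sum_(i <- r) U i x).
Proof.
move=> sU; elim: r => [|i r IH].
  by under eq_fun do rewrite big_nil; exact: small_on0.
by under eq_fun do rewrite big_cons; apply: small_on_add.
Qed.

Lemma small_on_comp (X W W' : completeNormedModType K) (Y : set X) (U : X -> W)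
    (V : W -> W') :
  bounded_op V -> small_on Y U -> small_on Y (fun x => V (U x)).
Proof.
move=> bV sU Y' e hY' Y'Y e0; have [M M0 hM] := bounded_op_gt0 bV.
have [|Y1 [hY1 Y1Y' hU]] := sU _ (e / M) hY' Y'Y; first by rewrite divr_gt0.
exists Y1; split=> // y /hU H; rewrite (le_trans (hM _))//.
by rewrite -ler_pdivlMl// (le_trans H)// mulrAC mulrC.
Qed.

End Subprojectivity.

(** * Finite rank operators as sums of rank one operators *)

Section FiniteRank.
Context {K : numFieldType} (hK : real_or_complex K).

Lemma scale_regularE (a : K) (x : K^o) : a *: x = a * x :> K. Proof. by []. Qed.

(** Induction on the length of a spanning list of the range.  If g is a bounded
    functional with g(v_n) = 1, then P - g(P .) v_n takes its values in the span of
    the vectors v_i - g(v_i) v_n with i < n. *)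
Lemma finite_rank_sum (X W : normedModType K) (P : X -> W) :
  bounded_op P -> finite_dim (range P) ->
  exists n (phi : nat -> X -> K^o) (e : nat -> W), (forall i, bounded_op (phi i)) /\
    forall x, P x = \sum_(i < n) (phi i x : K) *: e i.
Proof.
move=> bP /finite_dim_seq[s hs].
have {hs} : exists v : nat -> W, forall x, exists c : nat -> K,
    P x = \sum_(i < size s) c i *: v i.
  by exists (nth 0 s) => x; apply: hs; exists x.
elim: (size s) P bP => {s} [|n IH] P bP [v hv].
  exists 0%N, (fun=> fun=> 0), (fun=> 0); split=> [i|x]; first exact: bounded_op0.
  by have [c ->] := hv x; rewrite !big_ord0.
(* A zero vector at the end of the list can be dropped; it has no norming functional. *)
have [vn0|vn0] := eqVneq (v n) 0.
  apply: IH => //; exists v => x; have [c ->] := hv x; exists c.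
  by rewrite big_ord_recr/= vn0 scaler0 addr0.
have [f [lf fv fb]] := norming_functional hK (v n).
have bf : bounded_op f by split=> //; exists 1; split=> // x; rewrite mul1r.
pose g x : K^o := `|v n|^-1 *: f x.
have bg : bounded_op g by apply: bounded_op_scale.
have gv : g (v n) = 1 by rewrite /g fv /GRing.scale/= mulVf// normr_eq0.
have bgP : bounded_op (fun x => g (P x)) by apply: bounded_op_comp.
have [||m [phi [e [bphi He]]]] := IH (fun x => P x - (g (P x) : K) *: v n).
- by apply: bounded_op_sub => //; exact: bounded_op_rank1.
- exists (fun i => v i - (g (v i) : K) *: v n) => x.
  have [c ->] := hv x; exists c.
  rewrite (lin_sum bg.1) scaler_suml -sumrB big_ord_recr/=.
  rewrite (linZ bg.1) gv scale_regularE mulr1 subrr addr0.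
  apply: eq_bigr => i _.
  by rewrite (linZ bg.1) scale_regularE scalerBr scalerA.
exists m.+1, (fun i => if i == m then (fun x => g (P x)) else phi i),
  (fun i => if i == m then v n else e i); split=> [i|x].
  by case: (i == m) => //; exact: bphi.
rewrite big_ord_recr/= eqxx -[LHS](subrK ((g (P x) : K) *: v n)) He; congr (_ + _).
by apply: eq_bigr => i _; rewrite ltn_eqF.
Qed.

End FiniteRank.

(** * Perturbation of a complemented sequence *)

Section Perturbation.
Context {K : numFieldType} (hK : real_or_complex K).

Lemma converges_norm_le (X : normedModType K) (u : nat -> X) x M :
  converges u x -> (forall n, `|u n| <= M) -> `|x| <= M.
Proof.
move=> ux uM; apply/ler_addgt0Pl => e /ux[N /(_ _ (leqnn N)) H].
by rewrite -[x](subrK (u N)) (le_trans (ler_normD _ _))// lerD.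
Qed.

Lemma converges_lin (X : normedModType K) (u v : nat -> X) x y (a : K) :
  converges u x -> converges v y -> converges (fun n => a *: u n + v n) (a *: x + y).
Proof.
move=> /converges_cvg ux /converges_cvg vy; apply/converges_cvg.
by apply: cvgD => //; apply: cvgZr.
Qed.

Lemma geometric_converges (X : completeNormedModType K) (u : nat -> X) (C : K) :
  (forall n, `|u n.+1 - u n| <= C * 2^-1 ^+ n.+1) -> exists x, converges u x.
Proof.
move=> H; have C0 : 0 <= C.
  by have := le_trans (normr_ge0 _) (H 0%N); rewrite expr1 pmulr_lge0// half_gt0.
apply: complete_converges => e /(dyadic_small_mul hK C0)[N HN]; exists N => n Nn.
apply: le_trans (HN _ (leqnn N)); rewrite -(subnKC Nn).
suff : `|u N - u (N + (n - N))%N| <= C * (2^-1 ^+ N - 2^-1 ^+ (N + (n - N))).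
  by move/le_trans; apply; rewrite ler_wpM2l// gerBl halfX_ge0.
elim: (n - N)%N => [|k IH]; first by rewrite addn0 !subrr normr0 mulr0.
rewrite addnS (le_trans (ler_distD (u (N + k)%N) _ _))//.
apply: (le_trans (lerD IH (_ : _ <= C * 2^-1 ^+ (N + k).+1))).
  by rewrite distrC; exact: H.
rewrite -mulrDr ler_wpM2l//; set a := _ ^+ (N + k); set b := _ ^+ (N + k).+1.
have -> : a = b + b by rewrite /a -halfXS.
by rewrite opprD addrA addrNK.
Qed.

Lemma pointwise_limit (X Y : normedModType K) (T : nat -> X -> Y) (M : K) : 0 <= M ->
  (forall n, linear (T n)) -> (forall n x, `|T n x| <= M * `|x|) ->
  (forall x, exists y, converges (fun n => T n x) y) ->
  exists L : X -> Y, [/\ linear L, norm_bounded_by L M &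
    forall x, converges (fun n => T n x) (L x)].
Proof.
move=> M0 lT TM /choice[L hL]; exists L; split=> //.
  move=> a u v; apply: (converges_unique (hL _)).
  have := converges_lin a (hL u) (hL v).
  by under eq_fun do rewrite -lT.
by split=> // x; exact: converges_norm_le (hL x) (fun n => TM n x).
Qed.

(** The inverse is the limit of the iteration x |-> b - U x. *)
Lemma neumann_inverse (X : completeNormedModType K) (U : X -> X) :
  linear U -> norm_bounded_by U 2^-1 ->
  exists2 S : X -> X, bounded_op S &
    (forall x, S x + U (S x) = x) /\ (forall x, S (x + U x) = x).
Proof.
move=> lU [_ bU].
have low x : 2^-1 * `|x| <= `|x + U x|.
  have : `|x| <= `|x + U x| + 2^-1 * `|x|.
    rewrite -[x in `|x| <= _](addrK (U x)) (le_trans (ler_normB _ _))// lerD2l.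
    exact: bU.
  have {1}-> : `|x| = 2^-1 * `|x| + 2^-1 * `|x|.
    by rewrite -mulrDl -[X in X + X]mul1r -splitr mul1r.
  by rewrite lerD2r.
have solve b : exists x, x + U x = b.
  pose u n := iter n (fun x => b - U x) 0.
  have sub4 (p q : X) : b - p - (b - q) = - (p - q).
    by rewrite !opprB addrC addrA addrNK.
  have [n|x ux] := @geometric_converges _ u (2 * `|b|).
    elim: n => [|n IH].
      rewrite /u/= (lin0 lU) !subr0 expr1 mulrAC mulfV ?mul1r// pnatr_eq0//.
    have -> : u n.+2 - u n.+1 = - U (u n.+1 - u n).
      by rewrite (linB lU) /u 2!iterS sub4.
    rewrite normrN (le_trans (bU _))// exprS mulrCA ler_wpM2l//.
  exists x.
  have bopU : bounded_op U by split=> //; exists 2^-1; split=> //; rewrite ltW// half_gt0.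
  have H1 : converges (fun n => u n.+1) x.
    by move=> e /ux[N HN]; exists N => n Nn; apply: HN; exact: leqW.
  have H2 : converges (fun n => u n.+1) (b - U x).
    move=> e /(converges_bounded_op bopU ux)[N HN]; exists N => n /HN.
    by rewrite /u iterS sub4 normrN.
  by rewrite {1}(converges_unique H1 H2) subrK.
have [S hS] := choice solve.
have Vinj x y : x + U x = y + U y -> x = y.
  move=> H; apply/eqP; rewrite -subr_eq0 -normr_le0 -(ler_pM2l half_gt0) mulr0.
  rewrite (le_trans (low _))// (linB lU) addrACA H -opprD.
  by rewrite subrr normr0.
exists S; last by split=> // x; apply: Vinj.
split=> [a u v|].
  apply: Vinj; rewrite hS lU addrACA -scalerDr.
  by rewrite !hS.
exists 2; split=> // x; have := low (S x); rewrite hS.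
by rewrite mulrC ler_pdivrMr// mulrC.
Qed.

(** The principle of small perturbations.  R z = sum_j g_j(z) w_j is a projection,
    and V = 1 + U with U z = sum_j g_j(z) (y_j - w_j) is invertible since U has norm
    at most 1/2.  As V w_j = y_j, the operator V R V^-1 is a projection whose range
    is spanned by the y_j.  The series R z has finitely many nonzero terms for
    z in a dense set, hence it converges for all z by the uniform bound on its
    partial sums. *)
Lemma perturbed_complemented (X : completeNormedModType K) (Y : set X)
    (w y : nat -> X) (g : nat -> X -> K^o) (b C : K) :
  lin_subspace Y -> closed Y -> (forall j, Y (y j)) -> 0 < b -> 0 <= C ->
  (forall j, linear (g j)) -> (forall j x, `|g j x| <= b * `|x|) ->
  (forall i j, g i (w j) = (i == j)%:R) ->
  (forall n x, `|\sum_(j < n) (g j x : K) *: w j| <= C * `|x|) ->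
  (forall x e, 0 < e -> exists2 a, `|x - a| <= e &
     exists N, forall j, (N <= j)%N -> g j a = 0) ->
  (forall j, `|y j - w j| <= b^-1 * 2^-1 ^+ j.+2) ->
  has_complemented Y.
Proof.
move=> sY cY Yy b0 C0 lg bg gw Rb dense yw.
have lsum (v : nat -> X) n : linear (fun x => \sum_(j < n) (g j x : K) *: v j).
  by apply: linear_sumf => i; apply: linear_rank1.
have terms j x : `|(g j x : K) *: (y j - w j)| <= 2^-1 * `|x| * 2^-1 ^+ j.+1.
  rewrite normrZ (le_trans (ler_pM _ _ (bg j x) (yw j)))//.
  have -> // : b * `|x| * (b^-1 * 2^-1 ^+ j.+2) = 2^-1 * `|x| * 2^-1 ^+ j.+1 :> K.
  rewrite exprS; move: (_ ^+ j.+1) (`|x|) => p q; field.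
  by rewrite gt_eqF.
have [||||U [lU bU hU]] := @pointwise_limit _ _
   (fun n x => \sum_(j < n) (g j x : K) *: (y j - w j)) 2^-1.
- by rewrite ltW// half_gt0.
- exact: (lsum (fun j => y j - w j)).
- move=> n x; rewrite (le_trans (ler_norm_sum _ _ _))//.
  apply: (@le_trans _ _ (\sum_(j < n) 2^-1 * `|x| * 2^-1 ^+ j.+1)).
    by apply: ler_sum => j _; exact: terms.
  rewrite -mulr_sumr ler_piMr ?sum_halfX_le1// mulr_ge0// ltW// half_gt0//.
- move=> x; apply: (@geometric_converges _ _ (2^-1 * `|x|)) => n.
  by rewrite big_ord_recr/= addrAC subrr add0r; exact: terms.
have [||||R [lR bR hR]] := @pointwise_limit _ _
   (fun n x => \sum_(j < n) (g j x : K) *: w j) C.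
- by [].
- exact: (lsum w).
- exact: Rb.
- move=> x; apply: complete_converges => e e0.
  have C1 : 0 < C + C + 1 by rewrite ltr_wpDl// addr_ge0.
  have [|a xa [N HN]] := dense x (e / (C + C + 1)); first by rewrite divr_gt0.
  exists N => n Nn.
  have aE : \sum_(j < n) (g j a : K) *: w j = \sum_(j < N) (g j a : K) *: w j.
    rewrite -!(big_mkord xpredT (fun j => (g j a : K) *: w j)).
    rewrite (big_cat_nat (n := N))//= [X in _ + X]big_nat_cond.
    by rewrite [X in _ + X]big1 ?addr0// => i /andP[/andP[/HN->]]; rewrite scale0r.
  rewrite (le_trans (ler_distD (\sum_(j < N) (g j a : K) *: w j) _ _))//.
  rewrite -{2}aE -!(linB (lsum w _)) (@le_trans _ _ ((C + C) * `|x - a|))//.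
    by rewrite mulrDl lerD// [in leRHS]distrC; exact: Rb.
  rewrite (@le_trans _ _ ((C + C + 1) * `|x - a|))//.
    by rewrite ler_wpM2r// lerDl.
  by rewrite mulrC -ler_pdivlMr.
have [S bS [VS SV]] := neumann_inverse lU bU.
have bopR : bounded_op R by split=> //; exists C.
have bopU : bounded_op U by split=> //; exists 2^-1.
have bopV : bounded_op (fun x => x + U x) by apply: bounded_op_add => //; exact: bounded_op_id.
have single (v : nat -> X) j n : (j < n)%N -> \sum_(i < n) (g i (w j) : K) *: v i = v j.
  move=> jn; rewrite (bigD1 (Ordinal jn))//= gw eqxx scale1r big1 ?addr0// => i.
  by rewrite -val_eqE/= gw => /negPf->; rewrite scale0r.
have limit_single (v : nat -> X) j z :
    converges (fun n => \sum_(i < n) (g i (w j) : K) *: v i) z -> z = v j.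
  move=> H; apply: (converges_unique H) => e e0; exists j.+1 => n jn.
  by rewrite single// subrr normr0 ltW.
have Uw j : U (w j) = y j - w j.
  exact: (limit_single (fun j => y j - w j)) (hU (w j)).
have Rw j : R (w j) = w j by exact: limit_single (hR (w j)).
have Sy j : S (y j) = w j by rewrite -[RHS]SV Uw addrC subrK.
have RR x : R (R x) = R x.
  apply: (converges_unique _ (hR x)).
  have := converges_bounded_op bopR (hR x); congr (converges _ _); apply: funext => n.
  by rewrite (lin_sum lR); apply: eq_bigr => j _; rewrite (linZ lR) Rw.
pose Q x := R (S x) + U (R (S x)).
have bQ : bounded_op Q by apply: (bounded_op_comp bopV); exact: bounded_op_comp.
have QQ x : Q (Q x) = Q x by rewrite /Q SV RR.
have Qy j : Q (y j) = y j by rewrite /Q Sy Rw Uw addrC subrK.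
exists (range Q); split.
- split.
  + apply: lin_subspace_image => //; exact: bQ.1.
  + exact: closed_range_projection.
  + apply: independent_infinite_dim => n; exists y => [i _|]; first by exists (y i).
    apply: (@independent_triangular _ _ _ (fun i x => g i (S x))).
    * by move=> i; apply: (linear_comp (lg i)); exact: bS.1.
    * by move=> i; rewrite Sy gw eqxx.
    * by move=> i j ij; rewrite Sy gw ltn_eqF.
- move=> _ [x _ <-]; apply: (converges_closed cY _ (converges_bounded_op bopV (hR (S x)))).
  move=> n; rewrite (lin_sum bopV.1); apply: subspace_sum => // i _.
  by rewrite (linZ bopV.1) Uw addrC subrK; apply: subspaceZ.
- exact: complementedI bQ QQ _.
Qed.

End Perturbation.

(** * Averaging over signs *)

Section Signs.
Context {K : numFieldType}.

(** A vector with coordinates in [-1, 1] is a convex combination of sign vectors;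
    the coordinates are treated one at a time, the untreated ones being kept in v. *)
Lemma sign_domination (E : normedModType K) (M : K) J (x : nat -> E) :
  forall v, (forall eps : nat -> bool,
     `|v + \sum_(j < J) (-1) ^+ eps j *: x j| <= M) ->
  forall th : nat -> K, (forall j, -1 <= th j <= 1) ->
    `|v + \sum_(j < J) th j *: x j| <= M.
Proof.
elim: J => [|J IH] v H th th1.
  by have := H xpredT; rewrite !big_ord0.
have key (s : bool) : `|v + (-1) ^+ s *: x J + \sum_(j < J) th j *: x j| <= M.
  apply: IH => // eps.
  have := H (fun j => if j == J then s else eps j).
  rewrite big_ord_recr/= eqxx addrCA -addrA.
  rewrite addrCA addrA; under eq_bigr => i _ do rewrite ltn_eqF//.
  by rewrite -addrA [X in v + X]addrC.
rewrite big_ord_recr/=; set s := \sum_(j < J) _ in key *; set t := th J.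
have /andP[t1 t2] : -1 <= t <= 1 := th1 J.
have a0 : 0 <= (1 + t) / 2 by rewrite divr_ge0// -lerBlDl sub0r.
have b0 : 0 <= (1 - t) / 2 by rewrite divr_ge0// subr_ge0.
have -> : v + (s + t *: x J) =
    ((1 + t) / 2) *: (v + x J + s) + ((1 - t) / 2) *: (v - x J + s).
  rewrite ![v + _ + s]addrAC addrA; move: (v + s) => u.
  rewrite !scalerDr scalerN addrACA -scalerDl -scalerBl.
  have -> : (1 + t) / 2 + (1 - t) / 2 = 1 by field.
  have -> : (1 + t) / 2 - (1 - t) / 2 = t by field.
  by rewrite scale1r.
rewrite (le_trans (ler_normD _ _))//.
rewrite (normrZ ((1 + t) / 2)) (normrZ ((1 - t) / 2)) (ger0_norm a0) (ger0_norm b0).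
have -> : M = (1 + t) / 2 * M + (1 - t) / 2 * M by field.
have := key false; have := key true; rewrite expr0 expr1 scale1r scaleN1r => k1 k2.
by rewrite lerD// ler_wpM2l.
Qed.

(** The diagonal part of a double sum is its average over signs.  For one index,
    A v + a b is the mean of (A + a)(v + b) and (A - a)(v - b); the offsets A and v
    allow an induction that treats one index at a time. *)
Lemma sign_averaging (Y Z : normedModType K) (M : K) J (a : nat -> Y -> Z)
    (b : nat -> Y) : (forall j, linear (a j)) ->
  forall (A : Y -> Z) (v : Y), linear A ->
    (forall eps : nat -> bool,
      `|A (v + \sum_(j < J) (-1) ^+ eps j *: b j) +
        \sum_(j < J) (-1) ^+ eps j *: a j (v + \sum_(j < J) (-1) ^+ eps j *: b j)| <= M) ->
  `|A v + \sum_(j < J) a j (b j)| <= M.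
Proof.
move=> la; elim: J => [|J IH] A v lA H.
  by have := H xpredT; rewrite !big_ord0 !addr0.
have key (s : bool) : `|(A (v + (-1) ^+ s *: b J) + (-1) ^+ s *: a J (v + (-1) ^+ s *: b J))
    + \sum_(j < J) a j (b j)| <= M.
  apply: (IH (fun x => A x + (-1) ^+ s *: a J x)) => [|eps].
    by apply: linear_add => //; apply: linear_scale.
  have sumE (W : normedModType K) (c : nat -> W) :
      \sum_(i < J.+1) (-1) ^+ (if i == J :> nat then s else eps i) *: c i
      = \sum_(i < J) (-1) ^+ eps i *: c i + (-1) ^+ s *: c J.
    rewrite big_ord_recr/= eqxx; congr (_ + _).
    by apply: eq_bigr => i _; rewrite ltn_eqF.
  have := H (fun j => if j == J then s else eps j).
  rewrite (sumE _ b); set u := v + _.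
  rewrite (sumE _ (fun j => a j u)) => {sumE}.
  have -> : v + (-1) ^+ s *: b J + \sum_(j < J) (-1) ^+ eps j *: b j = u.
    by rewrite /u addrAC addrA.
  by rewrite addrAC addrA.
have := key false; have := key true.
rewrite expr0 expr1 !scale1r !scaleN1r; set r := \sum_(j < J) _ => k1 k2.
rewrite big_ord_recr/= -/r.
have -> : A v + (r + a J (b J)) = 2^-1 *: ((A (v + b J) + a J (v + b J) + r) +
    (A (v - b J) - a J (v - b J) + r)).
  rewrite !(linD lA) !(linD (la J)) !(linN lA) !(linN (la J)).
  move: (A v) (A (b J)) (a J v) (a J (b J)) => p q p' q'.
  have -> : p + q + (p' + q') + r + (p - q - (p' - q') + r) = 2 *: (p + (r + q')).
    rewrite opprB [p' + q']addrC [p + q + _]addrACA [p - q + _]addrACA -opprD.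
    move: (q + p') => w; have -> : p + (r + q') = (p + q') + r by rewrite addrA addrAC.
    move: (p + q') => u; rewrite [LHS]addrACA [u + w + _]addrACA subrr addr0.
    by rewrite addrACA scaler_nat mulr2n.
  by rewrite scalerA mulVf ?scale1r// pnatr_eq0.
rewrite normrZ (le_trans (ler_wpM2l _ (ler_normD _ _)))//.
rewrite ger0_norm// -ler_pdivlMl// (le_trans (lerD k2 k1))//.
by rewrite invrK mulr_natl mulr2n.
Qed.

End Signs.

(** * Tensor products of operators *)

Section SpanSubmodule.
Context {K : numFieldType} (V : lmodType K) (A : set V).

(** The span as a boolean predicate, to make it an instance of a submodule. *)
Definition in_span : {pred V} := fun u => `[< lin_span A u >].

Fact in_span_closed : submod_closed in_span.
Proof.
have sA := lin_span_subspace A; split; first by apply/asboolP; exact: subspace0.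
by move=> a u v /asboolP Au /asboolP Av; apply/asboolP; exact: sA.2.
Qed.

HB.instance Definition _ := GRing.isSubmodClosed.Build K V in_span in_span_closed.

Record span_type := SpanType { span_val : V; _ : span_val \in in_span }.
HB.instance Definition _ := [isSub for span_val].
HB.instance Definition _ := [Choice of span_type by <:].
HB.instance Definition _ := [SubChoice_isSubLmodule of span_type by <:].

End SpanSubmodule.

(** The universal property, applied with the span of the pure tensors as target,
    gives a linear map from A to this span which fixes the pure tensors; by
    uniqueness it is the identity. *)
Lemma alg_tensor_span (K : numFieldType) m (Y : 'I_m -> lmodType K) (A : lmodType K)
    (t : (forall i, Y i) -> A) : is_alg_tensor t -> forall u, lin_span (range t) u.
Proof.
move=> [mt univ] u.
have tin y : t y \in in_span (range t).
  by apply/asboolP; apply: lin_span_sub; exists y.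
pose f y : span_type (range t) := SpanType (tin y).
have mf : multilinear f.
  by move=> y i a x x'; apply: val_inj; rewrite linearP /=; exact: mt.
have [g gt _] := univ _ _ mf.
have lh : linear (fun x => val (g x)) by move=> a x y; rewrite !linearP.
have [h ht hu] := univ _ _ mt.
have H1 := hu (lin_pack lh) (fun y => congr1 val (gt y)).
have H2 := hu (lin_pack (@linear_id _ A)) (fun y => erefl).
have <- : val (g u) = u by rewrite -[LHS]/(lin_pack lh u) H1 -H2.
exact/asboolP/(valP (g u)).
Qed.

Section Tensors.
Context {K : numFieldType} (T : tensor_product K).

Section Family.
Context {m : nat} (X : 'I_m.+1 -> completeNormedModType K).

Definition tpure (y : forall i, X i) : tens_space T X :=
  tens_incl T X (tens_pure T y).

Lemma tpure_linear (y : forall i, X i) i : linear (fun u : X i => tpure (dfwith y i u)).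
Proof.
by move=> a u v; rewrite /tpure -linearP; congr (tens_incl T X _);
  exact: (tens_pureP T X).1.
Qed.

Lemma norm_tpure (y : forall i, X i) : `|tpure y| = \prod_(i < m.+1) `|y i|.
Proof. exact: norm_tens_pure. Qed.

Lemma tens_incl_span u : lin_span (range tpure) (tens_incl T X u).
Proof.
have [n [c [v [Av ->]]]] := alg_tensor_span (tens_pureP T X) u.
rewrite linear_sum; exists n, c, (fun i => tens_incl T X (v i)); split.
  by move=> i; have [y _ <-] := Av i; exists y.
by apply: eq_bigr => i _; rewrite linearZ.
Qed.

Lemma tens_dense (A : set (tens_space T X)) : lin_subspace A -> closed A ->
  (forall y, A (tpure y)) -> forall z, A z.
Proof.
move=> sA cA Ay z; apply: cA.
have : closure (range (tens_incl T X)) z by rewrite tens_incl_dense.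
apply: closure_subset => _ [u _ <-]; have := tens_incl_span u.
by apply: lin_span_min => // _ [y _ <-].
Qed.

(** Bounded operators on the tensor product are determined by their values on pure
    tensors; all the identities between operators below are checked there. *)
Lemma tens_ext (W : normedModType K) (U V : tens_space T X -> W) :
  bounded_op U -> bounded_op V -> (forall y, U (tpure y) = V (tpure y)) -> U =1 V.
Proof.
move=> bU bV UV z; apply/eqP; rewrite -subr_eq0; apply/eqP.
have bUV : bounded_op (fun z => U z - V z) by exact: bounded_op_sub.
apply: (tens_dense (A := [set z | U z - V z = 0])).
- apply: (lin_subspace_preim (B := [set 0]) bUV.1); exact: lin_subspace_set0.
- exact: closed_eq0.
- by move=> y; rewrite /= UV subrr.
Qed.

Lemma tpure_bounded_op (y : forall i, X i) i :
  bounded_op (fun u : X i => tpure (dfwith y i u)).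
Proof.
split; first exact: tpure_linear.
exists (\prod_(j < m.+1 | j != i) `|y j|); split; first exact: prodr_ge0.
move=> u; rewrite norm_tpure (bigD1 i)//= dfwithin mulrC ler_wpM2r//.
by under eq_bigr => j ji do rewrite dfwithout 1?eq_sym//.
Qed.

Lemma tpure_eq0 (y : forall i, X i) i : y i = 0 -> tpure y = 0.
Proof.
move=> yi0; apply/eqP; rewrite -normr_eq0 norm_tpure; apply/prodf_eq0.
by exists i => //; rewrite yi0 normr0.
Qed.

End Family.

Lemma tens_map_exists m (X Y : 'I_m.+1 -> completeNormedModType K)
    (S : forall i, X i -> Y i) (M : 'I_m.+1 -> K) :
  (forall i, linear (S i)) -> (forall i, norm_bounded_by (S i) (M i)) ->
  exists U : tens_space T X -> tens_space T Y,
    [/\ linear U, norm_bounded_by U (\prod_(i < m.+1) M i) &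
      forall y, U (tpure y) = tpure (fun i => S i (y i))].
Proof.
move=> lS SM; have [U Uy UM] := @tensor_map K T m X Y (fun i => lin_pack (lS i)) M SM.
by exists U; split => //; exact: linearP.
Qed.

Definition is_tmap m (X Y : 'I_m.+1 -> completeNormedModType K)
    (S : forall i, X i -> Y i) (U : tens_space T X -> tens_space T Y) : Prop :=
  bounded_op U /\ forall y, U (tpure y) = tpure (fun i => S i (y i)).

(** The tensor product of a family of operators, chosen by means of [cid]; it is
    unique by [tens_ext]. *)
Definition tmap m (X Y : 'I_m.+1 -> completeNormedModType K)
    (S : forall i, X i -> Y i) : tens_space T X -> tens_space T Y :=
  if pselect (exists U, is_tmap S U) is left e then projT1 (cid e) else fun=> 0.

Section TensorMaps.
Context {m : nat} {X Y : 'I_m.+1 -> completeNormedModType K}.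
Implicit Types S : forall i, X i -> Y i.

Lemma tmapP S : (forall i, bounded_op (S i)) -> is_tmap S (tmap S).
Proof.
move=> bS; rewrite /tmap; case: pselect => [e|]; first exact: (projT2 (cid e)).
have /choice[M SM] := fun i => (bS i).2.
have [U [lU UM Uy]] := tens_map_exists (fun i => (bS i).1) SM.
by case; exists U; split=> //; split=> //; eexists; exact: UM.
Qed.

Lemma tmap_bounded_op S : (forall i, bounded_op (S i)) -> bounded_op (tmap S).
Proof. by move=> /tmapP[]. Qed.

Lemma tmap_pure S y : (forall i, bounded_op (S i)) ->
  tmap S (tpure y) = tpure (fun i => S i (y i)).
Proof. by move=> /tmapP[_ ->]. Qed.

Lemma tmap_eq S U : (forall i, bounded_op (S i)) -> bounded_op U ->
  (forall y, U (tpure y) = tpure (fun i => S i (y i))) -> tmap S =1 U.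
Proof.
move=> bS bU Uy; apply: tens_ext => //; first exact: tmap_bounded_op.
by move=> y; rewrite tmap_pure.
Qed.

Lemma tmap_eq0 S i z : (forall j, bounded_op (S j)) -> (forall x, S i x = 0) -> tmap S z = 0.
Proof.
move=> bS S0; move: z; apply: (tmap_eq bS (bounded_op0 _ _)) => y.
by rewrite (tpure_eq0 (i := i)).
Qed.

Lemma tmap_bound S (M : K) : (forall i, linear (S i)) ->
  (forall i, norm_bounded_by (S i) M) -> norm_bounded_by (tmap S) (M ^+ m.+1).
Proof.
move=> lS SM; have bS i : bounded_op (S i) by split; [exact: lS|exists M].
have [U [lU UM Uy]] := tens_map_exists lS SM.
have -> : tmap S = U.
  by apply: funext; apply: tmap_eq => //; split=> //; exists (\prod_(i < m.+1) M).
by move: UM; rewrite prodr_const card_ord.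
Qed.

End TensorMaps.

Lemma tmap_comp m (X Y W : 'I_m.+1 -> completeNormedModType K)
    (S : forall i, Y i -> W i) (S' : forall i, X i -> Y i) z :
  (forall i, bounded_op (S i)) -> (forall i, bounded_op (S' i)) ->
  tmap S (tmap S' z) = tmap (fun i x => S i (S' i x)) z.
Proof.
move=> bS bS'; move: z; apply: fsym; apply: tmap_eq => [i||y].
- exact: bounded_op_comp.
- by apply: bounded_op_comp; exact: tmap_bounded_op.
- by rewrite !tmap_pure.
Qed.

Section Ampliation.
Context {m : nat} {X : 'I_m.+1 -> completeNormedModType K}.
Local Notation Z := (tens_space T X).

Definition slot i (S : X i -> X i) : forall j, X j -> X j :=
  dfwith (T := fun j => X j -> X j) (fun j => id) i S.

(** S acting on the i-th factor, the identity on the others. *)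
Definition ampl i (S : X i -> X i) : Z -> Z := tmap (slot S).

Definition head_family (r : nat) (S : forall i, X i -> X i) : forall i, X i -> X i :=
  fun i => if (i < r)%N then S i else id.

(** S acting on the first r factors only.  Going from r to r + 1 composes with one
    operator [ampl] ([head_mapS]), which is the basis of all the inductions over the
    factors. *)
Definition head_map r S : Z -> Z := tmap (head_family r S).

Lemma slotE i (S : X i -> X i) (y : forall j, X j) :
  (fun j => slot S (y j)) = dfwith y i (S (y i)) :> (forall j, X j).
Proof.
apply: functional_extensionality_dep => j.
have [ij|ij] := eqVneq i j; first by subst j; rewrite /slot !dfwithin.
by rewrite /slot !dfwithout.
Qed.

Lemma slot_bounded_op i (S : X i -> X i) : bounded_op S ->
  forall j, bounded_op (slot S (j := j)).
Proof.
move=> bS j; have [ij|ij] := eqVneq i j; first by subst j; rewrite /slot dfwithin.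
by rewrite /slot dfwithout//; exact: bounded_op_id.
Qed.

Lemma slot_bound i (S : X i -> X i) M : 1 <= M -> norm_bounded_by S M ->
  forall j, norm_bounded_by (slot S (j := j)) M.
Proof.
move=> M1 SM j; have [ij|ij] := eqVneq i j; first by subst j; rewrite /slot dfwithin.
rewrite /slot dfwithout//; apply: (norm_bounded_byW M1); exact: norm_bounded_by_id.
Qed.

Lemma ampl_bounded_op i (S : X i -> X i) : bounded_op S -> bounded_op (ampl S).
Proof. by move=> bS; apply: tmap_bounded_op; exact: slot_bounded_op. Qed.

Lemma ampl_pure i (S : X i -> X i) y : bounded_op S ->
  ampl S (tpure y) = tpure (dfwith y i (S (y i))).
Proof.
by move=> bS; rewrite /ampl tmap_pure ?slotE//; exact: slot_bounded_op.
Qed.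

Lemma ampl_eq i (S : X i -> X i) U : bounded_op S -> bounded_op U ->
  (forall y, U (tpure y) = tpure (dfwith y i (S (y i)))) -> ampl S =1 U.
Proof.
move=> bS bU Uy; apply: tens_ext => //; first exact: ampl_bounded_op.
by move=> y; rewrite ampl_pure.
Qed.

Lemma ampl_bound i (S : X i -> X i) M : linear S -> 1 <= M -> norm_bounded_by S M ->
  norm_bounded_by (ampl S) (M ^+ m.+1).
Proof.
move=> lS M1 SM; apply: tmap_bound => j.
  by have [] := @slot_bounded_op i S (conj lS (ex_intro _ M SM)) j.
exact: slot_bound.
Qed.

Lemma ampl_id i : ampl (@id (X i)) =1 id.
Proof.
apply: ampl_eq; [exact: bounded_op_id|exact: bounded_op_id|move=> y /=; congr (tpure _)].
apply: functional_extensionality_dep => j.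
have [ij|ij] := eqVneq i j; first by subst j; rewrite dfwithin.
by rewrite dfwithout.
Qed.

Lemma ampl_add i (S S' : X i -> X i) : bounded_op S -> bounded_op S' ->
  ampl (fun x => S x + S' x) =1 (fun z => ampl S z + ampl S' z).
Proof.
move=> bS bS'; apply: ampl_eq => [||y]; first exact: bounded_op_add.
  by apply: bounded_op_add; exact: ampl_bounded_op.
by rewrite !ampl_pure// (linD (tpure_linear y (i := i))).
Qed.

Lemma ampl_scale i (S : X i -> X i) c : bounded_op S ->
  ampl (fun x => c *: S x) =1 (fun z => c *: ampl S z).
Proof.
move=> bS; apply: ampl_eq => [||y]; first exact: bounded_op_scale.
  by apply: bounded_op_scale; exact: ampl_bounded_op.
by rewrite !ampl_pure// (linZ (tpure_linear y (i := i))).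
Qed.

Lemma ampl0 i : ampl (fun _ : X i => 0) =1 (fun z => 0).
Proof.
apply: ampl_eq; [exact: bounded_op0|exact: bounded_op0|move=> y].
by rewrite (lin0 (tpure_linear y (i := i))).
Qed.

Lemma ampl_sum i I (r : seq I) (S : I -> X i -> X i) : (forall k, bounded_op (S k)) ->
  ampl (fun x => \sum_(k <- r) S k x) =1 (fun z => \sum_(k <- r) ampl (S k) z).
Proof.
move=> bS; elim: r => [|k r IH] z.
  under [X in ampl X]eq_fun do rewrite big_nil.
  by rewrite big_nil ampl0.
under [X in ampl X]eq_fun do rewrite big_cons.
rewrite big_cons ampl_add ?IH//; exact: bounded_op_sum.
Qed.

Lemma head_bounded_op r S : (forall i, bounded_op (S i)) ->
  forall i, bounded_op (head_family r S (i := i)).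
Proof.
by move=> bS i; rewrite /head_family; case: ifP => // _; exact: bounded_op_id.
Qed.

Lemma head_map_bounded_op r S : (forall i, bounded_op (S i)) -> bounded_op (head_map r S).
Proof. by move=> bS; apply: tmap_bounded_op; exact: head_bounded_op. Qed.

Lemma head_map_bound r S M : (forall i, linear (S i)) -> 1 <= M ->
  (forall i, norm_bounded_by (S i) M) -> norm_bounded_by (head_map r S) (M ^+ m.+1).
Proof.
move=> lS M1 SM; apply: tmap_bound => i; rewrite /head_family; case: ifP => _.
- exact: lS.
- by [].
- exact: SM.
- apply: (norm_bounded_byW M1); exact: norm_bounded_by_id.
Qed.

Lemma head_map0 S : head_map 0 S =1 id.
Proof.
by apply: tmap_eq; [move=> i; exact: bounded_op_id|exact: bounded_op_id|].
Qed.

Lemma head_map_full S : head_map m.+1 S = tmap S.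
Proof.
congr tmap; apply: functional_extensionality_dep => i.
by rewrite /head_family ltn_ord.
Qed.

Lemma head_mapS (i : 'I_m.+1) S : (forall i, bounded_op (S i)) ->
  head_map i.+1 S =1 (fun z => head_map i S (ampl (S i) z)).
Proof.
move=> bS; apply: tmap_eq; first exact: head_bounded_op.
  by apply: bounded_op_comp; [exact: head_map_bounded_op|exact: ampl_bounded_op].
move=> y; rewrite ampl_pure// /head_map tmap_pure; last exact: head_bounded_op.
congr (tpure _); apply: functional_extensionality_dep => j.
rewrite /head_family; have [ij|ij] := eqVneq i j.
  by subst j; rewrite dfwithin ltnn leqnn.
have ijn : ((j : nat) == i) = false by rewrite (inj_eq val_inj) eq_sym; exact/negbTE.
by rewrite dfwithout// ltnS [(j <= i)%N]leq_eqVlt ijn.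
Qed.

(** 1 - S_0 x ... x S_r is (1 - S_0 x ... x S_(r-1)) plus the product
    S_0 x ... x S_(r-1) composed with the operator 1 - S_r acting on the r-th factor
    alone. *)
Lemma small_on_telescope (Y : set Z) (S : forall i, X i -> X i) :
  (forall i, bounded_op (S i)) ->
  (forall i, small_on Y (ampl (fun x => x - S i x))) ->
  small_on Y (fun z => z - tmap S z).
Proof.
move=> bS sS; rewrite -head_map_full.
have : (m.+1 <= m.+1)%N by []; elim: {1 3}m.+1 => [|r IH] rm.
  under eq_fun do rewrite head_map0 subrr.
  exact: small_on0.
pose i := Ordinal rm.
have -> : (fun z => z - head_map r.+1 S z) = (fun z => (z - head_map r S z) +
    head_map r S (ampl (fun x => x - S i x) z)).
  apply: funext => z; rewrite (head_mapS i bS) /=.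
  have -> : ampl (fun x => x - S i x) z = z - ampl (S i) z.
    under [X in ampl X]eq_fun do rewrite -scaleN1r.
    rewrite ampl_add ?ampl_id ?ampl_scale ?scaleN1r//; first exact: bounded_op_id.
    exact: bounded_op_scale.
  by rewrite (linB (head_map_bounded_op r bS).1) addrA subrK.
apply: small_on_add; first exact: IH (ltnW rm).
by apply: small_on_comp => //; exact: head_map_bounded_op.
Qed.

(** By uniform boundedness the set of those z for which U_n z tends to z is a closed
    subspace. *)
Lemma converges_dense (U : nat -> Z -> Z) (B : K) :
  (forall n, linear (U n)) -> (forall n, norm_bounded_by (U n) B) ->
  (forall y, converges (fun n => U n (tpure y)) (tpure y)) ->
  forall z, converges (fun n => U n z) z.
Proof.
move=> lU UB Uy; apply: tens_dense => //.
  split=> [|a u v Hu Hv] /=.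
    move=> e e0; exists 0%N => n _; rewrite (lin0 (lU n)) subrr normr0 ltW//.
  have := converges_lin a Hu Hv; congr (converges _ _).
  by apply: funext => n; rewrite lU.
apply/closedP => z H e e0; have B0 : 0 <= B := (UB 0%N).1.
have B2 : 0 < 1 + B by rewrite ltr_pwDl.
have [|a /= Ha za] := H (e / 2 / (1 + B)); first by rewrite !divr_gt0.
have [|N HN] := Ha (e / 2); first by rewrite divr_gt0.
exists N => n /HN H1; rewrite [e]splitr.
have -> : z - U n z = (a - U n a) + ((z - a) - U n (z - a)).
  by rewrite (linB (lU n)) addrACA -opprD !(addrC _ (_ - _)) !subrK.
rewrite (le_trans (ler_normD _ _))// lerD// (le_trans (ler_normB _ _))//.
rewrite (@le_trans _ _ ((1 + B) * `|z - a|))//.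
  by rewrite mulrDl mul1r lerD2l (UB n).2.
by rewrite mulrC -ler_pdivlMr.
Qed.

Lemma head_map_converges (S : nat -> forall i, X i -> X i) (M : K) r : 1 <= M ->
  (forall n i, linear (S n i)) -> (forall n i, norm_bounded_by (S n i) M) ->
  (forall i x, converges (fun n => S n i x) x) -> (r <= m.+1)%N ->
  forall z, converges (fun n => head_map r (S n) z) z.
Proof.
move=> M1 lS SM Sx; have bS n i : bounded_op (S n i) by split; [exact: lS|exists M].
have B0 : 0 <= M ^+ m.+1 by rewrite exprn_ge0// (le_trans _ M1).
have amplC i z : converges (fun n => ampl (S n i) z) z.
  move: z; apply: (@converges_dense _ (M ^+ m.+1)) => [n|n|y].
  - by have [] := ampl_bounded_op (bS n i).
  - exact: ampl_bound.
  - have := converges_bounded_op (tpure_bounded_op y i) (Sx i (y i)).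
    have -> : dfwith y i (y i) = y.
      apply: functional_extensionality_dep => j.
      have [ij|ij] := eqVneq i j; first by subst j; rewrite dfwithin.
      by rewrite dfwithout.
    by congr (converges _ _); apply: funext => n; rewrite ampl_pure.
elim: r => [|r IH] rm z.
  by move=> e e0; exists 0%N => n _; rewrite head_map0 subrr normr0 ltW.
pose i := Ordinal rm; move=> e e0; pose B := M ^+ m.+1 + 1.
have B1 : 0 < B by rewrite ltr_wpDl.
have [|N1 H1] := IH (ltnW rm) z (e / 2); first by rewrite divr_gt0.
have [|N2 H2] := amplC i z (e / 2 / B); first by rewrite !divr_gt0.
exists (maxn N1 N2) => n; rewrite geq_max => /andP[/H1 {}H1 /H2 {}H2].
rewrite (head_mapS i (bS n)) /= [e]splitr.
rewrite (le_trans (ler_distD (head_map r (S n) z) _ _))// lerD//.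
rewrite -(linB (head_map_bounded_op r (bS n)).1).
rewrite (le_trans ((head_map_bound r (lS n) M1 (SM n)).2 _))//.
rewrite (@le_trans _ _ (B * `|z - ampl (S n i) z|))//.
  by rewrite ler_wpM2r// lerDl.
by rewrite mulrC -ler_pdivlMr.
Qed.

(** Writing F_r(j) for the tensor product of the first r operators D_j, the relation
    F_(r+1)(j) = F_r(j) o ampl(D_j) makes sum_j eps_j F_(r+1)(j) the diagonal part of
    a product of two sums over j, which [sign_averaging] bounds.  The arbitrary signs
    eps are needed to go on with the induction. *)
Lemma diagonal_bound (D : nat -> forall i, X i -> X i) (M : K) : 1 <= M ->
  (forall j i, bounded_op (D j i)) ->
  (forall i J (eps : nat -> bool),
    norm_bounded_by (fun x => \sum_(j < J) (-1) ^+ eps j *: D j i x) M) ->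
  exists2 C, 0 <= C & forall J z, `|\sum_(j < J) tmap (D j) z| <= C * `|z|.
Proof.
move=> M1 bD DM; pose B := M ^+ m.+1.
have B0 : 0 <= B by rewrite exprn_ge0// (le_trans _ M1).
have amplB i J (eps : nat -> bool) z :
    `|\sum_(j < J) (-1) ^+ eps j *: ampl (D j i) z| <= B * `|z|.
  have bS : forall j, bounded_op (fun x => (-1) ^+ eps j *: D j i x).
    by move=> j; exact: bounded_op_scale.
  have -> : \sum_(j < J) (-1) ^+ eps j *: ampl (D j i) z =
      ampl (fun x => \sum_(j < J) (-1) ^+ eps j *: D j i x) z.
    rewrite ampl_sum//; apply: eq_bigr => j _; rewrite ampl_scale//.
  apply: (ampl_bound _ M1 (DM i J eps)).2.
  by have [] := @bounded_op_sum _ _ _ _ (index_enum 'I_J) xpredT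
    (fun j x => (-1) ^+ eps j *: D j i x) bS.
have headB r : (r < m.+1)%N -> forall J (eps : nat -> bool) z,
    `|\sum_(j < J) (-1) ^+ eps j *: head_map r.+1 (D j) z| <= B ^+ r.+1 * `|z|.
  elim: r => [|r IH] rm J eps z.
    rewrite expr1; have := amplB ord0 J eps z.
    congr (`|_| <= _); apply: eq_bigr => j _.
    by rewrite (head_mapS ord0 (bD j)) head_map0.
  pose i := Ordinal rm.
  have -> : \sum_(j < J) (-1) ^+ eps j *: head_map r.+2 (D j) z =
     0 + \sum_(j < J) (fun u => (-1) ^+ eps j *: head_map i (D j) u) (ampl (D j i) z).
    by rewrite add0r; apply: eq_bigr => j _; rewrite (head_mapS i (bD j)).
  apply: (@sign_averaging _ _ _ _ J (fun j u => (-1) ^+ eps j *: head_map i (D j) u)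
    (fun j => ampl (D j i) z) _ (fun=> 0) 0).
  - by move=> j; apply: linear_scale; have [] := head_map_bounded_op i (bD j).
  - exact: linear_cst0.
  move=> eta; rewrite !add0r.
  under eq_bigr do rewrite scalerA -signr_addb.
  rewrite (le_trans (IH (ltnW rm) J (fun j => eta j (+) eps j) _))//.
  by rewrite [in leRHS]exprSr -mulrA ler_wpM2l// exprn_ge0.
exists (B ^+ m.+1); first by rewrite exprn_ge0.
move=> J z; have := headB m (ltnSn m) J (fun=> false) z.
under eq_bigr do rewrite expr0 scale1r head_map_full.
by [].
Qed.

End Ampliation.
End Tensors.

(** * Rank one operators on a factor *)

Section RankOne.
Context {K : numFieldType} (hK : real_or_complex K).

(** The map a |-> a e embeds the scalars in the complete space X, and phi is a left
    inverse. *)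
Lemma scalars_complete (X : completeNormedModType K) (phi : X -> K^o) (e : X) :
  bounded_op phi -> phi e = 1 ->
  forall F : set_system K^o, ProperFilter F -> cauchy F -> cvg F.
Proof.
move=> bphi phie F FF Fc.
have M0 : 0 < `|e| + 1 by rewrite ltr_wpDl.
have [l Gl] : exists l : X, (fun a : K^o => (a : K) *: e) @ F --> l.
  apply/cvg_ex; apply: cauchy_cvg; apply: cauchy_exP => eps eps0.
  have [|x Fx] := (cauchyP F).1 Fc (eps / (`|e| + 1)); first by rewrite divr_gt0.
  exists ((x : K) *: e).
  suff : F [set a : K^o | ball ((x : K) *: e) eps ((a : K) *: e)] by [].
  apply: filterS Fx => a; rewrite -!ball_normE /= => H.
  rewrite -scalerBl normrZ (@le_lt_trans _ _ (`|x - a| * (`|e| + 1)))//.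
    by rewrite ler_wpM2l// lerDl.
  by rewrite -ltr_pdivlMr.
apply/cvg_ex; exists (phi l); apply/(@cvgrPdist_le K K^o _ F _ (fun a => a)) => eps eps0.
have [M M1 phiM] := bounded_op_gt0 bphi.
have := (cvgrPdist_le _ _).1 Gl (eps / M); rewrite divr_gt0// => /(_ _ isT).
apply: filterS => a; rewrite ler_pdivlMr// mulrC => H.
apply: le_trans H; have := phiM (l - (a : K) *: e).
by rewrite (linB bphi.1) (linZ bphi.1) phie scale_regularE mulr1.
Qed.

(** The line L is the field of scalars itself, c is the coordinate with respect to
    e1.  The rest of the section only uses these properties. *)
Lemma one_dimensional_exists (X : completeNormedModType K) (e : X) : e != 0 ->
  exists (L : completeNormedModType K) (c : L -> K^o) (e1 : L),
    [/\ bounded_op c, bounded_op (fun a : K^o => (a : K) *: e1), c e1 = 1 &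
        forall x, x = (c x : K) *: e1].
Proof.
move=> e0; have [f [lf fe fb]] := norming_functional hK e.
have bf : bounded_op f by split=> //; exists 1; split=> // x; rewrite mul1r.
have bphi : bounded_op (fun x => `|e|^-1 *: f x) by exact: bounded_op_scale.
have phie : `|e|^-1 *: f e = 1 by rewrite fe scale_regularE mulVf// normr_eq0.
pose L : completeNormedModType K := HB.pack K^o
  (Uniform_isComplete.Build K^o (scalars_complete bphi phie)).
exists L, (fun x => x), (1 : K^o); split.
- exact: bounded_op_id.
- split=> [a u v|]; first by rewrite scalerDl scalerA.
  by exists 1; split=> // x; rewrite normrZ normr1 mulr1 mul1r.
- by [].
- by move=> x; rewrite -[RHS]/((x : K) * 1) mulr1.
Qed.

Section Factor.
Context (T : tensor_product K) (m : nat) (X : 'I_m.+2 -> completeNormedModType K).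
Context (i : 'I_m.+2) (phi : X i -> K^o) (e : X i).
Hypothesis bphi : bounded_op phi.

Let sub_family (j : 'I_m.+1) := X (lift i j).

Section Line.
Context (L : completeNormedModType K) (c : L -> K^o) (e1 : L).
Hypotheses (bc : bounded_op c) (be1 : bounded_op (fun a : K^o => (a : K) *: e1))
  (ce1 : c e1 = 1) (cE : forall x, x = (c x : K) *: e1).

(** The factor with index i is replaced by the line L.  The test on indices is
    abstracted as a boolean b, so that statements about the dependent types below can
    be proved by case analysis on b. *)
Definition line_or (b : bool) (V : completeNormedModType K) : completeNormedModType K :=
  if b then L else V.

Definition to_line (b : bool) (V : completeNormedModType K) (f : V -> K^o) :
    V -> line_or b V :=
  if b return V -> line_or b V then fun x => (f x : K) *: e1 else id.

Definition of_line (b : bool) (V : completeNormedModType K) (v : V) :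
    line_or b V -> V :=
  if b return line_or b V -> V then fun x => (c x : K) *: v else id.

Lemma to_line_bounded_op b (V : completeNormedModType K) (f : V -> K^o) :
  bounded_op f -> bounded_op (@to_line b V f).
Proof.
by move=> bf; case: b; [exact: (bounded_op_comp be1 bf)|exact: bounded_op_id].
Qed.

Lemma of_line_bounded_op b (V : completeNormedModType K) (v : V) :
  bounded_op (@of_line b V v).
Proof. by case: b; [exact: bounded_op_rank1|exact: bounded_op_id]. Qed.

Lemma of_lineK b (V : completeNormedModType K) (f : V -> K^o) v x :
  b = false -> @of_line b V v (@to_line b V f x) = x.
Proof. by move->. Qed.

Lemma line_generator b (V : completeNormedModType K) (v : V) : b = true ->
  exists e1' : line_or b V,
  [/\ e1' != 0, lin_span [set e1'] = setT, @of_line b V v e1' = v &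
      forall f x, @to_line b V f x = (f x : K) *: e1'].
Proof.
move=> ->; exists e1; split=> //=.
- apply/eqP => e10; have := oner_neq0 K; rewrite -ce1 e10.
  by rewrite (lin0 bc.1) eqxx.
- apply/seteqP; split=> // x _; rewrite [x]cE.
  apply: subspaceZ; first exact: lin_span_subspace.
  exact: lin_span_sub.
- by rewrite ce1 scale1r.
Qed.

(** phi maps the i-th factor to the line L, which can be dropped; conversely L is
    inserted and mapped to the line of e.  Both A and B are tensor products of
    operators up to the isomorphism J that drops L. *)
Lemma rank1_factor_line : exists (A : tens_space T X -> tens_space T sub_family)
    (B : tens_space T sub_family -> tens_space T X),
  [/\ bounded_op A, bounded_op B & forall z, B (A z) = ampl (fun x => (phi x : K) *: e) z].
Proof.
pose Y j := line_or (j == i) (X j).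
pose phis : forall j, X j -> K^o := dfwith (fun j _ => 0) i phi.
pose es : forall j, X j := dfwith (fun j => 0) i e.
pose F j : X j -> Y j := to_line (j == i) (phis j).
pose G j : Y j -> X j := of_line (es j).
have bF j : bounded_op (F j).
  apply: to_line_bounded_op; have [ij|ij] := eqVneq i j.
    by subst j; rewrite /phis dfwithin.
  by rewrite /phis dfwithout//; exact: bounded_op0.
have bG j : bounded_op (G j) by exact: of_line_bounded_op.
have GF j x : i != j -> G j (F j x) = x.
  by move=> ij; apply: of_lineK; rewrite eq_sym; exact/negbTE.
have [e1' [e10 spane1 Ge1 Fe1]] := line_generator (es i) (eqxx i).
have [J Jiso Jpure] := @drop_factor K T m Y i e1' e10 spane1.
have [bJ [J' bJ' [JJ' J'J]]] := linear_isomorphism_bounded_op Jiso.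
pose A z := tmap (fun j => G (lift i j)) (J' (tmap F z)).
pose B z := tmap G (J (tmap (fun j => F (lift i j)) z)).
have bA : bounded_op A.
  apply: bounded_op_comp; first by apply: tmap_bounded_op => j; exact: bG.
  by apply: bounded_op_comp => //; exact: tmap_bounded_op.
have bB : bounded_op B.
  apply: bounded_op_comp; first exact: tmap_bounded_op.
  by apply: bounded_op_comp => //; apply: tmap_bounded_op => j; exact: bF.
have bC : bounded_op (tmap (T := T) (fun j => G (lift i j))).
  by apply: tmap_bounded_op => j; exact: bG.
exists A, B; split=> // z; symmetry; move: z.
apply: ampl_eq; [exact: bounded_op_rank1|exact: bounded_op_comp|move=> y].
(* y' carries the generator of L at index i, so the specification of J applies to it. *)
pose y' : forall j, Y j := dfwith (fun j => F j (y j)) i e1'.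
have y'i : y' i = e1' by rewrite /y' dfwithin.
have y'lift : (fun j => y' (lift i j)) = (fun j => F (lift i j) (y (lift i j))).
  by apply: functional_extensionality_dep => j; rewrite /y' dfwithout// neq_lift.
have Jy' : J (tpure T (fun j => y' (lift i j))) = tpure T y' := Jpure y' y'i.
have AE : A (tpure T y) = (phi (y i) : K) *: tpure T (fun j => y (lift i j)).
  rewrite /A tmap_pure//.
  have -> : tpure T (fun j => F j (y j)) = (phi (y i) : K) *: tpure T y'.
    have -> : (fun j => F j (y j)) = dfwith y' i ((phi (y i) : K) *: e1').
      apply: functional_extensionality_dep => j; have [ij|ij] := eqVneq i j.
        by subst j; rewrite dfwithin /F Fe1 /phis dfwithin.
      by rewrite dfwithout// /y' dfwithout.
    rewrite (linZ (tpure_linear T y' (i := i))); congr (_ *: tpure _ _).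
    apply: functional_extensionality_dep => j; have [ij|ij] := eqVneq i j.
      by subst j; rewrite dfwithin.
    by rewrite dfwithout.
  rewrite (linZ bJ'.1) -Jy' JJ' (linZ bC.1).
  rewrite tmap_pure; last by move=> j; exact: bG.
  congr (_ *: tpure _ _); apply: functional_extensionality_dep => j.
  have /(congr1 (fun h => h j)) /= -> := y'lift.
  by rewrite GF// neq_lift.
rewrite AE (linZ bB.1) /B tmap_pure; last by move=> j; exact: bF.
rewrite -y'lift Jy' tmap_pure// (linZ (tpure_linear T y (i := i))).
congr (_ *: tpure _ _); apply: functional_extensionality_dep => j.
have [ij|ij] := eqVneq i j.
  by subst j; rewrite y'i dfwithin /G Ge1 /es dfwithin.
by rewrite /y' !dfwithout// GF.
Qed.

End Line.

(** For e = 0 there is no line to use, but then the operator is zero. *)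
Lemma rank1_factor : exists (A : tens_space T X -> tens_space T sub_family)
    (B : tens_space T sub_family -> tens_space T X),
  [/\ bounded_op A, bounded_op B & forall z, B (A z) = ampl (fun x => (phi x : K) *: e) z].
Proof.
have [e0|/one_dimensional_exists[L [c [e1 [bc be1 ce1 cE]]]]] := eqVneq e 0; last first.
  exact: rank1_factor_line bc be1 ce1 cE.
exists (fun=> 0), (fun=> 0); split; [exact: bounded_op0|exact: bounded_op0|move=> z].
have -> : (fun x => (phi x : K) *: e) = (fun=> 0).
  by apply: funext => x; rewrite e0 scaler0.
by rewrite ampl0.
Qed.

End Factor.

Lemma small_on_finite_rank (T : tensor_product K) m
    (X : 'I_m.+2 -> completeNormedModType K) i (P : X i -> X i) (Y : set (tens_space T X)) :
  subprojective (tens_space T (fun j => X (lift i j))) -> ~ has_complemented Y ->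
  bounded_op P -> finite_dim (range P) -> small_on Y (ampl P).
Proof.
move=> subW nY bP fP; have [n [phi [e [bphi PE]]]] := finite_rank_sum hK bP fP.
have -> : ampl (T := T) P = (fun z => \sum_(k < n) ampl (fun x => (phi k x : K) *: e k) z).
  apply: funext => z; rewrite -ampl_sum; last by move=> k; exact: bounded_op_rank1.
  by congr (ampl _ z); apply: funext => x; rewrite PE.
apply: small_on_sum => k.
have [A [B [bA bB BA]]] := rank1_factor T (e k) (bphi k).
have -> : ampl (T := T) (fun x => (phi k x : K) *: e k) = (fun z => B (A z)).
  by apply: funext => z; rewrite BA.
by apply: small_on_comp => //; exact: small_on_subprojective hK _ _ _ _ _ _ _.
Qed.

End RankOne.

(** * Unconditional sequence spaces and blocks *)

Section SequenceSpace.
Context {K : numFieldType} (E : uncond_seq_space K).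

(** [sign_domination] for the vectors b_j e_j and the coefficients a_j / b_j; if
    b_j = 0 then a_j = 0 as well, and the coefficient is 0. *)
Lemma unit_vec_domination : exists2 M : K, 0 <= M & forall J (a b : nat -> K),
  (forall j, 0 <= a j <= b j) ->
  `|\sum_(j < J) a j *: unit_vec E j| <= M * `|\sum_(j < J) b j *: unit_vec E j|.
Proof.
have [_ _ _ [M HM]] := unit_vec_basis E.
exists M; first exact: (HM 0%N xpredT).1.
move=> J a b ab; set x := \sum_(j < J) b j *: _.
have coordx n : (n < J)%N -> Defs.coord E n x = b n.
  move=> nJ; rewrite /x linear_sum (bigD1 (Ordinal nJ))//= linearZ /= coord_unit_vec.
  rewrite eqxx [X in X + _]mulr1 big1 ?addr0// => i.
  by rewrite -val_eqE/= linearZ /= coord_unit_vec eq_sym => /negPf->; exact: mulr0.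
have -> : \sum_(j < J) a j *: unit_vec E j =
   0 + \sum_(j < J) (a j / b j) *: (b j *: unit_vec E j).
  rewrite add0r; apply: eq_bigr => j _; rewrite scalerA.
  have [b0|b0] := eqVneq (b j) 0; last by rewrite divfK.
  have /andP[a0 ab0] := ab j; rewrite b0 mulr0.
  by have /eqP-> : a j == 0 by rewrite eq_le a0 -b0 ab0.
apply: (@sign_domination _ _ (M * `|x|) J (fun j => b j *: unit_vec E j) 0 _
  (fun j => a j / b j)) => [eps|j].
  rewrite add0r; have := (HM J eps).2 x; congr (`|_| <= _).
  by apply: eq_bigr => j _; rewrite coordx.
have /andP[a0 ab0] := ab j.
have [b0|b0] := eqVneq (b j) 0; first by rewrite b0 invr0 mulr0 lerN10 ler01.
have bpos : 0 < b j by rewrite lt_neqAle eq_sym b0 (le_trans a0).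
by rewrite ler_pdivrMr// mul1r ab0 andbT (le_trans (lerN10 _))// divr_ge0// ltW.
Qed.

End SequenceSpace.

Section Blocks.
Context {K : numFieldType} (V : lmodType K) (P : nat -> V -> V).
Hypotheses (lP : forall n, linear (P n)) (PP : forall n x, P n (P n x) = P n x)
  (P0 : forall n m, n != m -> forall x, P n (P m x) = 0).

Definition block (a b : nat) (x : V) : V := \sum_(a <= n < b) P n x.

Lemma P_block k a b x : P k (block a b x) = if (a <= k < b)%N then P k x else 0.
Proof.
rewrite /block (lin_sum (@lP k)); case: ifP => [kab|/negbT kab].
  rewrite (bigD1_seq k) ?mem_index_iota ?iota_uniq//= PP big1 ?addr0// => n nk.
  by rewrite P0// eq_sym.
rewrite big_nat_cond big1// => n /andP[nab _]; apply: P0.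
by apply: contraNneq kab => ->.
Qed.

Lemma block_block_disjoint a b c d x :
  (forall k, (a <= k < b)%N -> (c <= k < d)%N -> False) ->
  block a b (block c d x) = 0.
Proof.
move=> H; rewrite {1}/block big_nat_cond big1// => k /andP[kab _]; rewrite P_block.
by case: ifP => // /(H k kab).
Qed.

Lemma block_block_sub a b c d x : (c <= a)%N -> (b <= d)%N ->
  block a b (block c d x) = block a b x.
Proof.
move=> ca bd; apply: eq_big_nat => k /andP[ak kb]; rewrite P_block.
by rewrite (leq_trans ca ak) (leq_trans kb bd).
Qed.

Lemma block_sub a b x : (a <= b)%N -> block 0 b x - block 0 a x = block a b x.
Proof. by move=> ab; rewrite /block (big_cat_nat (n := a))//= addrAC subrr add0r. Qed.

(** Signs on blocks are signs on the projections P n, constant on each block; hence the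
    unconditionality constant of P bounds the signed sums of blocks. *)
Lemma block_signs (N : nat -> nat) J (eps : nat -> bool) :
  N 0%N = 0%N -> (forall j, (N j <= N j.+1)%N) -> exists eta : nat -> bool, forall x,
  \sum_(j < J) (-1) ^+ eps j *: block (N j) (N j.+1) x =
  \sum_(n < N J) (-1) ^+ eta n *: P n x.
Proof.
move=> N0 NS; elim: J => [|J [eta IH]].
  by exists xpredT => x; rewrite N0 !big_ord0.
exists (fun n => if (n < N J)%N then eta n else eps J) => x.
rewrite big_ord_recr/= IH -(big_mkord xpredT (fun n => (-1) ^+ eta n *: P n x)).
rewrite -(big_mkord xpredT
  (fun n => (-1) ^+ (if (n < N J)%N then eta n else eps J) *: P n x)).
rewrite [RHS](big_cat_nat (n := N J))//=; congr (_ + _).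
  by apply: eq_big_nat => n /andP[_ ->].
rewrite /block scaler_sumr; apply: eq_big_nat => n /andP[Nn _].
by rewrite ltnNge Nn.
Qed.

End Blocks.

Section Estimate.
Context {K : numFieldType} (T : tensor_product K) (m : nat).
Context (X : 'I_m.+1 -> completeNormedModType K) (P : forall i, nat -> X i -> X i).

(** A tensor product of operators maps algebraic tensors to algebraic tensors. *)
Lemma block_tensor_span (D : forall i, X i -> X i) (B : forall i, set (X i)) u :
  (forall i, bounded_op (D i)) -> (forall i x, B i (D i x)) ->
  exists2 w, lin_span [set z | exists2 y : forall i, X i, forall i, B i (y i) &
    z = tens_pure T y] w & tens_incl T X w = tmap (T := T) D (tens_incl T X u).
Proof.
move=> bD BD.
have [n [c [v [Av ->]]]] := alg_tensor_span (tens_pureP T X) u.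
have /choice[y hy] : forall k, exists y, tens_pure T y = v k.
  by move=> k; have [y _ <-] := Av k; exists y.
exists (\sum_(k < n) c k *: tens_pure T (fun i => D i (y k i))).
  exists n, c, (fun k => tens_pure T (fun i => D i (y k i))); split=> // k.
  by exists (fun i => D i (y k i)).
rewrite !linear_sum (lin_sum (tmap_bounded_op T bD).1); apply: eq_bigr => k _.
rewrite !linearZ /= (linZ (tmap_bounded_op T bD).1) -hy; congr (_ *: _).
by rewrite -/(tpure T (y k)) tmap_pure.
Qed.

(** The E-estimate for sequences of the form (B_j z_j) with B_j the tensor product of
    the projections onto the j-th blocks, which are those that occur in the proof.  The
    truncation w' complies with the requirement of finitely many nonzero terms. *)
Lemma estimate_tmap (E : uncond_seq_space K) :
  (forall i n, bounded_op (@P i n)) -> satisfies_estimate T (fun i => @P i) E ->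
  exists2 C : K, 0 < C & forall (N : nat -> nat) (z : nat -> tens_space T X) J,
    N 0%N = 0%N -> (forall j, (N j < N j.+1)%N) ->
    (forall j, range (tens_incl T X) (z j)) ->
    let v j := tmap (fun i => block (@P i) (N j) (N j.+1)) (z j) in
    let normE := `|\sum_(j < J) `|v j| *: unit_vec E j| in
    normE <= C * `|\sum_(j < J) v j| /\ `|\sum_(j < J) v j| <= C * normE.
Proof.
move=> bP [C C1 est]; have C0 : 0 < C by rewrite (lt_le_trans ltr01).
exists C => // N z J N0 NS hz v.
have bB j i : bounded_op (block (@P i) (N j) (N j.+1)) by apply: bounded_op_sum => n.
have /choice[w hw] : forall j, exists w, lin_span
      [set z | exists2 y : forall i, X i,
         (forall i, @FDD_block K m X (fun i => @P i) i (N j) (N j.+1) (y i)) &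
         z = tens_pure T y] w /\
    tens_incl T X w = v j.
  move=> j; have [u _ uz] := hz j.
  have [|w wB wv] := @block_tensor_span _
    (fun i => @FDD_block K m X (fun i => @P i) i (N j) (N j.+1)) u (bB j).
    by move=> i x; exists (fun n => @P i n x) => // n; exists x.
  by exists w; split=> //; rewrite wv uz.
pose w' j := if (j < J)%N then w j else 0.
have [|j Jj|] := est w' J.
- exists N; split=> // j; rewrite /w'; case: ifP => _; first exact: (hw j).1.
  by apply: subspace0; exact: lin_span_subspace.
- by rewrite /w' ltnNge Jj.
rewrite linear_sum.
have -> : \sum_(j < J) tens_incl T X (w' j) = \sum_(j < J) v j.
  by apply: eq_bigr => j _; rewrite /w' ltn_ord (hw j).2.
have -> : \sum_(j < J) `|tens_incl T X (w' j)| *: unit_vec E j =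
    \sum_(j < J) `|v j| *: unit_vec E j.
  by apply: eq_bigr => j _; rewrite /w' ltn_ord (hw j).2.
by rewrite ler_pdivrMl.
Qed.

End Estimate.

(** * The gliding hump *)

Section BlockArgument.
Context {K : numFieldType} (hK : real_or_complex K) (T : tensor_product K) (m : nat).
Context (X : 'I_m.+1 -> completeNormedModType K) (P : forall i, nat -> X i -> X i).
Hypothesis hFDD : forall i, unconditional_FDD (@P i).
Local Notation Z := (tens_space T X).

Let bP i n : bounded_op (@P i n).
Proof. by have [/(_ n)[lP cP _ _] _ _ _] := hFDD i; exact: continuous_bounded_op. Qed.
Let lP i n : linear (@P i n) := (bP i n).1.
Let PP i n x : @P i n (@P i n x) = @P i n x.
Proof. by have [/(_ n)[_ _ H _] _ _ _] := hFDD i. Qed.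
Let P0 i n k : n != k -> forall x, @P i n (@P i k x) = 0.
Proof. by have [_ H _ _] := hFDD i; exact: H. Qed.

Lemma bounded_op_block i a b : bounded_op (block (@P i) a b).
Proof. by apply: bounded_op_sum => n; exact: bP. Qed.

Lemma closed_inf_unit (V : completeNormedModType K) (Y : set V) : closed_inf_subspace Y ->
  exists y, Y y /\ `|y| = 1.
Proof.
move=> [sY _ iY]; have [v Yv iv] := infinite_dim_independent 1 iY.
have v0 : v 0%N != 0.
  apply/eqP => v0; have := iv (fun=> 1); rewrite big_ord1 v0 scaler0.
  by move=> /(_ erefl 0%N isT)/eqP; rewrite oner_eq0.
exists (`|v 0%N|^-1 *: v 0%N); split; first by apply: subspaceZ => //; exact: Yv.
by rewrite normrZ normfV normr_id mulVf// normr_eq0.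
Qed.

Lemma uniform_constant : exists2 M : K, 1 <= M & forall i N (eps : nat -> bool),
  norm_bounded_by (fun x => \sum_(n < N) (-1) ^+ eps n *: @P i n x) M.
Proof.
have /choice[M HM] : forall i, exists M : K, forall N (eps : nat -> bool),
    norm_bounded_by (fun x => \sum_(n < N) (-1) ^+ eps n *: @P i n x) M.
  by move=> i; have [_ _ _] := hFDD i.
have M0 i : 0 <= M i := (HM i 0%N xpredT).1.
exists (1 + \sum_i M i); first by rewrite lerDl sumr_ge0.
move=> i N eps; apply: norm_bounded_byW (HM i N eps).
by rewrite (bigD1 i)//= addrCA lerDl addr_ge0// sumr_ge0.
Qed.

(** Given N_j, smallness provides a unit vector y_j of Y close to Q_(N_j) y_j; then an
    algebraic tensor u_j close to y_j, and N_(j+1) such that u_j is close to its image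
    under the tensor product PS of the partial sums.  As B_j = Q_(N_j) PS_(N_(j+1)),
    the vector w_j = B_j u_j is close to y_j, and it is the block-diagonal sequence to
    which the estimate applies. *)
Lemma block_argument (E : uncond_seq_space K) (Y : set Z) :
  satisfies_estimate T (fun i => @P i) E -> closed_inf_subspace Y ->
  (forall n, small_on Y (fun z => z - tmap (fun i x => x - block (@P i) 0 n x) z)) ->
  has_complemented Y.
Proof.
move=> est hY small; have [sY cY iY] := hY.
have [M M1 HM] := uniform_constant.
have M0 : 0 <= M by rewrite (le_trans _ M1).
pose S n i := block (@P i) 0 n.
pose R n i x := x - block (@P i) 0 n x.
have bS n i : bounded_op (S n i) by exact: bounded_op_block.
have bR n i : bounded_op (R n i).
  by apply: bounded_op_sub; [exact: bounded_op_id|exact: bounded_op_block].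
have SM n i : norm_bounded_by (S n i) M.
  have := HM i n (fun=> false); congr norm_bounded_by; apply: funext => x.
  by rewrite /S /block big_mkord; apply: eq_bigr => k _; rewrite expr0 scale1r.
pose M2 := 1 + M; have M21 : 1 <= M2 by rewrite lerDl.
have RM n i : norm_bounded_by (R n i) M2.
  apply: norm_bounded_by_add; first exact: norm_bounded_by_id.
  by apply: norm_bounded_by_opp; exact: SM.
pose PS n : Z -> Z := tmap (S n).
pose Q n : Z -> Z := tmap (R n).
pose q := M2 ^+ m.+1.
have q1 : 1 <= q by rewrite exprn_ege1.
have q0 : 0 < q by rewrite (lt_le_trans ltr01).
have bPS n : bounded_op (PS n) by apply: tmap_bounded_op.
have bQ n : bounded_op (Q n) by apply: tmap_bounded_op.
have SM2 n i : norm_bounded_by (S n i) M2.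
  by apply: (norm_bounded_byW _ (SM n i)); rewrite lerDr.
have Qq n z : `|Q n z| <= q * `|z|.
  by have [_] := @tmap_bound K T m X X (R n) M2 (fun i => (bR n i).1) (RM n); apply.
have PSq n z : `|PS n z| <= q * `|z|.
  by have [_] := @tmap_bound K T m X X (S n) M2 (fun i => (bS n i).1) (SM2 n); apply.
have PSz z : converges (fun n => PS n z) z.
  have := @head_map_converges K T m X S M m.+1 M1 (fun n i => (bS n i).1) SM _ (leqnn _) z.
  under eq_fun do rewrite head_map_full; apply=> i x.
  apply/converges_cvg; have [_ _ /(_ x) H _] := hFDD i.
  by under eq_fun do rewrite /S /block big_mkord.
(* b will bound the norms of the functionals g_j, since |B_j z| <= q^2 |z| and |w_j| >= 1/2.
   The errors d_j are chosen so that |w_j - y_j| <= 3 q d_j = b^-1 2^-(j+2), as required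
   by the perturbation lemma. *)
pose b : K := 2 * q ^+ 2.
have b0 : 0 < b by rewrite mulr_gt0// exprn_gt0.
pose d j : K := (3 * q)^-1 * (b^-1 * 2^-1 ^+ j.+2).
have d0 j : 0 < d j.
  apply: mulr_gt0; first by rewrite invr_gt0 mulr_gt0.
  by apply: mulr_gt0; [rewrite invr_gt0|exact: halfX_gt0].
have /choice[f hf] : forall jn : nat * nat, exists r : Z * Z * nat,
   [/\ Y r.1.1 /\ `|r.1.1| = 1, `|Q jn.2 r.1.1 - r.1.1| <= d jn.1,
       range (tens_incl T X) r.1.2 /\ `|r.1.2 - r.1.1| <= d jn.1,
       (jn.2 < r.2)%N & `|PS r.2 r.1.2 - r.1.2| <= d jn.1].
  move=> [j n] /=.
  have [Y' [hY' Y'Y small']] := small n Y (d j) hY (fun _ => id) (d0 j).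
  have [y [Yy y1]] := closed_inf_unit hY'.
  have : closure (range (tens_incl T X)) y by rewrite tens_incl_dense.
  move=> /closureP/(_ _ (d0 j))[u ru yu].
  have [k hk] := PSz u _ (d0 j).
  exists (y, u, maxn k n.+1); split=> /=.
  - by split=> //; exact: Y'Y.
  - by rewrite distrC (le_trans (small' _ Yy))// y1 mulr1.
  - by split=> //; rewrite distrC.
  - by rewrite leq_maxr.
  - by rewrite distrC hk// leq_maxl.
pose N j := nat_rect (fun=> nat) 0%N (fun j n => (f (j, n)).2) j.
pose y j := (f (j, N j)).1.1; pose u j := (f (j, N j)).1.2.
have Yy j : Y (y j) by have [[]] := hf (j, N j).
have y1 j : `|y j| = 1 by have [[]] := hf (j, N j).
have Qy j : `|Q (N j) (y j) - y j| <= d j by have [] := hf (j, N j).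
have ru j : range (tens_incl T X) (u j) by have [_ _ []] := hf (j, N j).
have uy j : `|u j - y j| <= d j by have [_ _ []] := hf (j, N j).
have NS j : (N j < N j.+1)%N by have [] := hf (j, N j).
have PSu j : `|PS (N j.+1) (u j) - u j| <= d j by have [] := hf (j, N j).
have Nmono i j : (i <= j)%N -> (N i <= N j)%N.
  by move=> /subnK<-; elim: (j - i)%N => //= k /leq_trans; apply; exact: ltnW.
have leN j : (j <= N j)%N by elim: j => // j IH; exact: leq_ltn_trans IH (NS j).
pose D j i := block (@P i) (N j) (N j.+1).
have bD j i : bounded_op (D j i) by exact: bounded_op_block.
pose B j : Z -> Z := tmap (D j).
have bB j : bounded_op (B j) by exact: tmap_bounded_op.
have BE j z : B j z = Q (N j) (PS (N j.+1) z).
  rewrite /Q /PS tmap_comp//; congr (tmap _ z).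
  apply: functional_extensionality_dep => i; apply: funext => x; rewrite /R /S.
  rewrite (block_block_sub (@lP i) (@PP i) (@P0 i))//; last exact: ltnW.
  by rewrite block_sub// ltnW.
have Bq j z : `|B j z| <= q ^+ 2 * `|z|.
  by rewrite BE (le_trans (Qq _ _))// expr2 -mulrA ler_wpM2l// ltW.
have Bdiag i j z : B i (B j z) = if i == j then B j z else 0.
  rewrite /B tmap_comp//; have [->|ij] := eqVneq i j.
    congr (tmap _ z); apply: functional_extensionality_dep => k; apply: funext => x.
    by rewrite /D (block_block_sub (@lP k) (@PP k) (@P0 k)).
  apply: (tmap_eq0 (i := ord0)) => [k|x]; first exact: bounded_op_comp.
  apply: (block_block_disjoint (@lP _) (@PP _) (@P0 _)) => k /andP[k1 k2] /andP[k3 k4].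
  case: (ltngtP i j) ij => // ij _.
    by have := leq_trans k2 (leq_trans (Nmono _ _ ij) k3); rewrite ltnn.
  by have := leq_trans k4 (leq_trans (Nmono _ _ ij) k1); rewrite ltnn.
have BPS j n z : (n <= N j)%N -> B j (PS n z) = 0.
  move=> nN; rewrite /B /PS tmap_comp//.
  apply: (tmap_eq0 (i := ord0)) => [k|x]; first exact: bounded_op_comp.
  apply: (block_block_disjoint (@lP _) (@PP _) (@P0 _)) => k /andP[k1 k2] /andP[k3 k4].
  by have := leq_trans k4 (leq_trans nN k1); rewrite ltnn.
pose w j := B j (u j).
have wy j : `|w j - y j| <= b^-1 * 2^-1 ^+ j.+2.
  have -> : w j - y j = Q (N j) (PS (N j.+1) (u j) - u j) + Q (N j) (u j - y j) +
      (Q (N j) (y j) - y j).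
    have tele (x1 x2 x3 : Z) : (x1 - x2) + (x2 - x3) = x1 - x3 by rewrite addrA subrK.
    by rewrite -(linD (bQ _).1) tele (linB (bQ _).1) tele /w BE.
  have -> : b^-1 * 2^-1 ^+ j.+2 = q * d j + q * d j + q * d j.
    by rewrite /d; field; rewrite !gt_eqF// ?mulr_gt0.
  rewrite (le_trans (ler_normD _ _))// lerD//.
    rewrite (le_trans (ler_normD _ _))// lerD// (le_trans (Qq _ _))//.
      by rewrite ler_wpM2l// ltW.
    by rewrite ler_wpM2l// ltW.
  by rewrite (le_trans (Qy j))// ler_peMl// ltW.
(* b^-1 2^-(j+2) <= 1/2, and y_j is a unit vector. *)
have w_low j : 2^-1 <= `|w j|.
  have H : b^-1 * 2^-1 ^+ j.+2 <= 2^-1.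
    rewrite -[leRHS]mul1r ler_pM ?invr_ge0 ?halfX_ge0//; first exact: ltW.
      rewrite invf_le1// /b mulr_ege1//; first by rewrite ler1n.
      by rewrite exprn_ege1.
    by rewrite -[leRHS]expr1 halfX_le.
  have := le_trans (wy j) H; rewrite distrC => {}H.
  have : `|y j| <= `|w j| + 2^-1.
    by rewrite -[y j](subrK (w j)) addrC (le_trans (ler_normD _ _))// lerD2l.
  rewrite y1 [X in X <= _]splitr mul1r lerD2r; exact.
have w_gt0 j : 0 < `|w j| by rewrite (lt_le_trans _ (w_low j))// half_gt0.
have /choice[phi hphi] : forall j, exists phi : Z -> K^o,
    [/\ linear phi, phi (w j) = `|w j| & forall x, `|phi x| <= `|x|].
  by move=> j; exact: norming_functional.
have lphi j : linear (phi j) by have [] := hphi j.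
pose g j z : K^o := `|w j|^-1 *: phi j (B j z).
have lg j : linear (g j).
  by apply: linear_scale; apply: (linear_comp (lphi j)); exact: (bB j).1.
have g_norm j z : `|g j z| * `|w j| <= `|B j z|.
  rewrite normrZ normfV normr_id mulrAC mulVf ?mul1r ?gt_eqF//.
  by have [_ _] := hphi j; apply.
have gb j z : `|g j z| <= b * `|z|.
  rewrite -(ler_pM2r (w_gt0 j)) (le_trans (g_norm j z))// (le_trans (Bq j z))//.
  have -> : q ^+ 2 * `|z| = b * `|z| * 2^-1 by rewrite /b; field.
  by rewrite ler_wpM2l// mulr_ge0// ltW.
have gw i j : g i (w j) = (i == j)%:R.
  rewrite /g /w Bdiag; have [->|ij] := eqVneq i j; last first.
    by rewrite (lin0 (lphi i)) scaler0.
  rewrite -/(w j); have [_ -> _] := hphi j.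
  by rewrite scale_regularE mulVf// gt_eqF.
have bg j : bounded_op (g j) by split=> //; exists b; split=> //; exact: ltW.
have [C C0 diag] : exists2 C, 0 <= C & forall J z, `|\sum_(j < J) B j z| <= C * `|z|.
  apply: (@diagonal_bound K T m X D M M1 bD) => i J eps.
  have [eta Heta] := block_signs (@P i) J eps (erefl : N 0%N = 0%N) (fun j => ltnW (NS j)).
  by have := HM i (N J) eta; congr norm_bounded_by; apply: funext => x; rewrite Heta.
have [CE CE0 estB] := estimate_tmap bP est.
have [ME ME0 dom] := unit_vec_domination E.
(* On algebraic tensors: the estimate, domination in E of the coefficients
   |g_j(x)| |w_j| by |B_j x|, the estimate again, and the diagonal bound. *)
have sumb n x : `|\sum_(j < n) (g j x : K) *: w j| <= (CE * (ME * (CE * C))) * `|x|.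
  have C'0 : 0 <= CE * (ME * (CE * C)).
    by rewrite mulr_ge0 ?mulr_ge0// ltW.
  have bsum : bounded_op (fun x => \sum_(j < n) (g j x : K) *: w j).
    by apply: bounded_op_sum => j; exact: bounded_op_rank1.
  have cl := closed_norm_le C'0 bsum (bounded_op_id Z).
  suff H : range (tens_incl T X) `<=`
      [set x | `|\sum_(j < n) (g j x : K) *: w j| <= CE * (ME * (CE * C)) * `|id x|].
    apply: cl; apply: (closure_subset H); rewrite tens_incl_dense//.
  move=> z rz /=.
  have rgu j : range (tens_incl T X) ((g j z : K) *: u j).
    by have [v _ <-] := ru j; exists ((g j z : K) *: v) => //; rewrite linearZ.
  have [_] := estB N (fun j => (g j z : K) *: u j) n erefl NS rgu.
  have [+ _] := estB N (fun=> z) n erefl NS (fun=> rz).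
  rewrite -/(B _ _) => H1.
  have -> : \sum_(j < n) tmap (fun i => block (@P i) (N j) (N j.+1)) ((g j z : K) *: u j) =
     \sum_(j < n) (g j z : K) *: w j.
    by apply: eq_bigr => j _; rewrite -[tmap _]/(B j) (linZ (bB j).1).
  move/le_trans; apply; rewrite -!mulrA ler_wpM2l//; first exact: ltW.
  have := dom n (fun j => `|B j ((g j z : K) *: u j)|) (fun j => `|B j z|).
  move/(_ _)/le_trans; apply.
    by move=> j; rewrite normr_ge0 (linZ (bB j).1) normrZ g_norm.
  rewrite ler_wpM2l// (le_trans H1)// ler_wpM2l//; first exact: ltW.
  exact: diag.
apply: (@perturbed_complemented _ hK _ Y w y g b (CE * (ME * (CE * C)))) => //.
- by rewrite mulr_ge0 ?mulr_ge0// ltW.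
- move=> x e e0; have [n hn] := PSz x e e0.
  exists (PS n x); first exact: hn.
  exists n => j nj; rewrite /g BPS ?(lin0 (lphi j)) ?scaler0//.
  exact: leq_trans nj (leN j).
- by move=> j; rewrite distrC.
Qed.

End BlockArgument.

(** * The theorem *)

Lemma ltn_lift n (i : 'I_n.+1) (a b : 'I_n) : (a < b)%N -> (lift i a < lift i b)%N.
Proof.
move=> ab; rewrite /lift /= /bump -addnS leq_add//.
by case: (leqP i a) => // /leq_trans -> //; exact: ltnW.
Qed.

Theorem theorem3p1 (K : numFieldType) (hK : real_or_complex K)
    (T : tensor_product K) (k : nat)
    (X : 'I_k.+1 -> completeNormedModType K)
    (P : forall i, nat -> X i -> X i)
    (hinf : forall i, infinite_dim [set: X i])
    (hsub : forall i, subprojective (X i))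
    (hFDD : forall i, unconditional_FDD (P i))
    (hest : forall (l : nat) (s : 'I_l.+1 -> 'I_k.+1),
       (forall a b : 'I_l.+1, (a < b)%N -> (s a < s b)%N) ->
       exists E : uncond_seq_space K,
         satisfies_estimate T (fun a => P (s a)) E) :
  subprojective (tens_space T X).
Proof.
elim: k X P hinf hsub hFDD hest => [|k IH] X P hinf hsub hFDD hest Y hY.
  have [J /linear_isomorphism_bounded_op[bJ [J' bJ' [_ J'J]]] _] := one_fold T X.
  apply: (pullback_complemented hK (hsub ord0) bJ' hY).
  have [M M0 JM] := bounded_op_gt0 bJ; exists M^-1; first by rewrite invr_gt0.
  by move=> y _; rewrite ler_pdivrMl// -[y in leLHS]J'J.
have [//|nY] := pselect (has_complemented Y).
have [E est] := hest k.+1 id (fun a b ab => ab).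
apply: (block_argument hK hFDD est hY) => n.
have bP i j : bounded_op (P i j).
  by have [/(_ j)[lP cP _ _] _ _ _] := hFDD i; exact: continuous_bounded_op.
have bblock i : bounded_op (block (P i) 0 n) by apply: bounded_op_sum => j.
apply: small_on_telescope => i; first by apply: bounded_op_sub => //; exact: bounded_op_id.
have -> : (fun x => x - (x - block (P i) 0 n x)) = block (P i) 0 n.
  by apply: funext => x; rewrite subKr.
have -> : ampl (T := T) (block (P i) 0 n) =
    (fun z => \sum_(j <- index_iota 0 n) ampl (P i j) z).
  by apply: funext => z; rewrite -ampl_sum.
(* Dropping a factor leaves a product to which the induction hypothesis applies:
   increasing sequences of its indices remain increasing after the lift. *)
apply: small_on_sum => j; apply: small_on_finite_rank => //.
- apply: (IH _ (fun a => P (lift i a))) => // l s hs.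
  apply: (hest l (fun a => lift i (s a))) => a b ab.
  by apply: ltn_lift; apply: hs.
- by have [/(_ j)[]] := hFDD i.
Qed.
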